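(* Scalar parameter: let $\hat\theta$ be a point estimator and let $g_{\hat\theta}=\ell'_{\hat\theta}$ be its image under the score map. Then $$\Lambda(g_{\hat\theta})=I_{\hat\theta},\qquad \mathrm{Eff}^{\Lambda}(g_{\hat\theta})=\frac{I_{\hat\theta}}{I}\le 1,$$ where $I_{\hat\theta}$ is the Fisher information of the marginal model of the statistic $\hat\theta$, with equality (efficiency equal to $1$) exactly when $\hat\theta$ is sufficient. Multivariate form: let $\hat\mu$ be an estimator of a $k$-dimensional parameter $\mu$ and let $g_{\hat\mu}$, the marginal score of the statistic $\hat\mu$, be its image under the score map. Then $$\Lambda(g_{\hat\mu})=I_{\hat\mu},$$ the Fisher information matrix of the marginal model of $\hat\mu$. The efficiency $$\mathrm{Eff}^{\Lambda}(g_{\hat\mu})=I^{-1/2}I_{\hat\mu}I^{-1/2}$$ is bounded above by the $k\times k$ identity matrix and equals the identity exactly when $\hat\mu$ is sufficient.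
   Context: $M$ is a family of probability distributions with common support $\mathcal{Y}$, forming an open smooth manifold with a global parameterization onto an open subset $\Theta$ of $\mathbb{R}^k$ (with $k=1$ in the scalar case, parameter $\theta$; in the multivariate form the parameter is written $\mu$). $\ell$ is the log-likelihood of the full sample, with $\ell'$ its derivative in $\theta$, $\nabla\ell$ its gradient and $\partial_j\ell$ its partial derivative in the $j$th parameter component. $I$ is the Fisher information of $M$, that is, the variance (covariance matrix) of the full-sample score $\ell'$ (respectively $\nabla\ell$). A generalized estimator is a function $g$ on $\mathcal{Y}\times\Theta$ (with values in $\mathbb{R}$, or in $\mathbb{R}^k$ in the multivariate case) that has expectation zero at every parameter value, is square-integrable at each parameter value, and is smooth in the parameter; all generalized estimators considered, including the score-map images, are assumed to satisfy these conditions, and the scores are taken under mild regularity conditions. Expectations, variances, covariances, $\Lambda$, $\mathrm{Eff}^\Lambda$ and Fisher information are all functions of the parameter (equivalently, functions on $M$). For scalar parameter, the $\Lambda$-information of $g$ is $\Lambda(g)=\{E(g')\}^2/V(g)$, where $g'$ is the derivative in the parameter and $V$ is variance, and the $\Lambda$-efficiency is $\mathrm{Eff}^{\Lambda}(g)=\Lambda(g)/I$. In the multivariate case $\Lambda(g)=C^{t}V^{-1}(g)\,C$, where $C_{ij}=\mathrm{Cov}(g_i,\partial_j\ell)=-E(\partial_j g_i)$ and $V(g)$ is the covariance matrix of $g$, and $\mathrm{Eff}^{\Lambda}(g)=I^{-1/2}\Lambda(g)I^{-1/2}$. Score map: the marginal distributions of a statistic $\hat\theta$ under the members of $M$ form a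 statistical model, the marginal model of $\hat\theta$, with log-likelihood $\ell_{\hat\theta}(y,\theta)$, the log of the density of $\hat\theta$ evaluated at $\hat\theta(y)$. The score map sends $\hat\theta$ to the score of this model, $g_{\hat\theta}=\ell'_{\hat\theta}$ (in the multivariate case, the gradient of the marginal log-likelihood of $\hat\mu$ in the parameter). $I_{\hat\theta}$ (respectively $I_{\hat\mu}$) is the Fisher information of the marginal model, that is, the variance (covariance matrix) of this marginal score.
   Formalization: The parameter set Θ is assumed connected: on a disconnected Θ an estimator can have efficiency 1 everywhere without being sufficient (the sample mean for N(θ,1), θ in (0,1), together with N(θ,2), θ in (2,3)). *)

(* Defs.v *)
From HB Require Import structures.
From mathcomp Require Import all_boot all_order all_algebra.
From mathcomp Require Import all_classical all_reals all_analysis.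
Set Implicit Arguments.
Unset Strict Implicit.
Unset Printing Implicit Defensive.
Import Order.TTheory GRing.Theory Num.Theory.
Import numFieldNormedType.Exports.

Local Open Scope classical_set_scope.
Local Open Scope ring_scope.

(* Notions common to the scalar (V = R) and multivariate (V = 'rV[R]_k)
   parameter spaces. *)
Section Models.
Context {R : realType} {V : normedModType R}.
Implicit Types (Theta : set V).

(* C^n on the open set U through iterated directional derivatives: for
   finite-dimensional V this is the usual notion. *)
Fixpoint Cn_on (n : nat) (U : set V) (f : V -> R) : Prop :=
  if n is m.+1
  then forall v : V,
    (forall x, U x -> derivable f x v) /\ Cn_on m U ('D_v f)
  else forall x, U x -> {for x, continuous f}.

Definition smooth_on (U : set V) (f : V -> R) : Prop :=
  forall n, Cn_on n U f.

Definition diff_under_integral d (T : measurableType d)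
    (mu : {measure set T -> \bar R}) (A : set T) Theta (f : V -> T -> R) :=
  forall (theta v : V), Theta theta ->
    mu.-integrable A (EFin \o (fun x => 'D_v (f^~ x) theta)) /\
    is_derive theta v (fun t : V => \int[mu]_(x in A) f t x)
                      (\int[mu]_(x in A) 'D_v (f^~ x) theta).

(* {P theta | theta in Theta} has densities f theta with respect to mu and
   common support S.  The densities are smooth in the parameter, and the
   probability of an event can be differentiated under the integral sign (the
   regularity condition under which scores are taken).  P and f are relevant
   only on Theta. *)
Record regular_model d (T : measurableType d)
    (mu : {measure set T -> \bar R}) Theta
    (P : V -> probability T R) (f : V -> T -> R) (S : set T) : Prop :=
  RegularModel {
    density_measurable : forall theta, Theta theta ->
      measurable_fun [set: T] (f theta) ;
    density_ge0 : forall theta x, Theta theta -> 0 <= f theta x ;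
    density_support : forall theta x, Theta theta -> (0 < f theta x <-> S x) ;
    densityE : forall theta A, Theta theta -> measurable A ->
      P theta A = (\int[mu]_(x in A) (f theta x)%:E)%E ;
    density_smooth : forall x, smooth_on Theta (f^~ x) ;
    density_diff : forall A, measurable A -> diff_under_integral mu A Theta f
  }.

Definition identifiable d (T : measurableType d) Theta
    (P : V -> probability T R) :=
  forall theta1 theta2, Theta theta1 -> Theta theta2 ->
    (forall A, measurable A -> P theta1 A = P theta2 A) -> theta1 = theta2.

Definition log_likelihood {T : Type} (f : V -> T -> R) (theta : V) (x : T) : R :=
  ln (f theta x).

Record generalized_estimator d (Y : measurableType d) Theta
    (P : V -> probability Y R) (g : V -> Y -> R) : Prop :=
  GeneralizedEstimator {
    ge_sqr_integrable : forall theta, Theta theta ->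
      g theta \in Lfun (P theta) 2%:E ;
    ge_mean0 : forall theta, Theta theta -> ('E_(P theta)[g theta] = 0)%E ;
    ge_smooth : forall y, smooth_on Theta (g^~ y)
  }.

(* T is sufficient: the conditional probability of every event given T has a
   version kappa that does not depend on the parameter. *)
Definition sufficient d d' (Y : measurableType d) (Z : measurableType d')
    Theta (P : V -> probability Y R) (T : Y -> Z) : Prop :=
  forall A : set Y, measurable A ->
    exists2 kappa : Z -> R, measurable_fun [set: Z] kappa &
      forall theta (B : set Z), Theta theta -> measurable B ->
        P theta (A `&` T @^-1` B) =
        (\int[P theta]_(y in T @^-1` B) (kappa (T y))%:E)%E.

(* The family of marginal distributions of T. *)
Definition marginal d d' (Y : measurableType d) (Z : measurableType d')
    (P : V -> probability Y R) (T : {mfun Y >-> Z}) (theta : V)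
    : probability Z R := distribution (P theta) T.

End Models.

Section Scalar.
Context {R : realType}.

Definition score {T : Type} (f : R -> T -> R) (theta : R) (x : T) : R :=
  derive1 (fun t => log_likelihood f t x) theta.

Context d {Y : measurableType d}.
Implicit Types (P : R -> probability Y R) (p g : R -> Y -> R) (theta : R).

Definition fisher P p theta : R := fine 'V_(P theta)[score p theta].

(* x / 0 = 0, so Lambda g = 0 at a parameter where g is degenerate. *)
Definition Lambda P g theta : R :=
  fine 'E_(P theta)[fun y => derive1 (g^~ y) theta] ^+ 2 /
  fine 'V_(P theta)[g theta].

Definition Eff P p g theta : R := Lambda P g theta / fisher P p theta.

End Scalar.

Section Multivariate.
Context {R : realType} {k : nat}.

Definition psdmx (A : 'M[R]_k) : Prop :=
  A^T = A /\ forall u : 'rV[R]_k, 0 <= (u *m A *m u^T) 0 0.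

Definition pdmx (A : 'M[R]_k) : Prop :=
  A^T = A /\ forall u : 'rV[R]_k, u != 0 -> 0 < (u *m A *m u^T) 0 0.

(* Loewner order. *)
Definition lemx (A B : 'M[R]_k) : Prop := psdmx (B - A).

(* A^{-1/2}, the positive definite square root of A^{-1}; it exists and is
   unique when A is positive definite. *)
Definition invsqrtmx (A : 'M[R]_k) : 'M[R]_k :=
  xget 0 [set S | pdmx S /\ S *m S = invmx A].

Definition mscore {T : Type} (f : 'rV[R]_k -> T -> R) (mu : 'rV[R]_k) (x : T)
    : 'rV[R]_k :=
  \row_(j < k) 'D_(delta_mx 0 j) (fun m => log_likelihood f m x) mu.

Context d {Y : measurableType d}.
Implicit Types (P : 'rV[R]_k -> probability Y R) (p : 'rV[R]_k -> Y -> R).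
Implicit Types (g h : 'rV[R]_k -> Y -> 'rV[R]_k) (mu : 'rV[R]_k).

Definition covmx P g h mu : 'M[R]_k :=
  \matrix_(i < k, j < k)
    fine (covariance (P mu) (fun y => g mu y 0 i) (fun y => h mu y 0 j)).

Definition mfisher P p mu : 'M[R]_k := covmx P (mscore p) (mscore p) mu.

(* C^t V(g)^{-1} C with C_ij = Cov(g_i, d_j l); only meaningful when V(g) is
   invertible (invmx is the identity on singular matrices). *)
Definition mLambda P p g mu : 'M[R]_k :=
  (covmx P g (mscore p) mu)^T *m invmx (covmx P g g mu)
    *m covmx P g (mscore p) mu.

Definition mEff P p g mu : 'M[R]_k :=
  invsqrtmx (mfisher P p mu) *m mLambda P p g mu
    *m invsqrtmx (mfisher P p mu).

End Multivariate.

(* R^k with its Borel sigma-algebra. *)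
Notation borel_rV R k := (g_sigma_algebraType (@open 'rV[R]_k)).

(* Main.v *)
From HB Require Import structures.
Require Import Defs.
From mathcomp Require Import all_boot all_order all_algebra.
From mathcomp Require Import all_classical all_reals all_analysis.
From mathcomp Require Import measurable_realfun sesquilinear spectral.
From mathcomp Require complex.
From mathcomp Require Import ring lra.
Import Order.TTheory GRing.Theory Num.Theory.
Import numFieldNormedType.Exports.
Local Open Scope classical_set_scope.
Local Open Scope ring_scope.
Set Implicit Arguments.
Unset Strict Implicit.
Unset Printing Implicit Defensive.

(** Write s for the score of the sample, h for the score of the marginal model
    of T, and g = h o T.  The probability of the event {T in B} is the integral
    of p over the preimage of B, and also the integral of q over B.
    Differentiating both expressions in the parameter shows that s and g have
    the same integral over every event {T in B} ([integral_gap]).  Thus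
    g = E[s | T], and s - g is orthogonal to every function of T
    ([gap_orthogonal]).

    It follows that Cov(g, s) = V(g) = I_T, so that C^t V(g)^-1 C collapses to
    I_T, and that I - I_T is the second moment matrix of s - g
    ([integral_gap_gap], [mfisher_gap]).  This matrix is positive semidefinite,
    which is the bound on the efficiency.  For a scalar parameter the numerator
    of Lambda is E(g'), which is -Cov(g, s) because E(g) = 0 can be
    differentiated under the integral sign ([expectation_derive1]).

    The efficiency is 1 at every parameter exactly when s = g almost
    everywhere at every parameter, and this is equivalent to sufficiency
    ([gap0_sufficient]).  Indeed s - g is the derivative of
    ln p(y) - ln q(T y) in the parameter.  Suppose that it vanishes almost
    everywhere at each parameter.  It is continuous in the parameter, so the
    exceptional null sets of a countable dense set of parameters serve for all
    parameters; off their union the ratio p(y) / q(T y) is constant on the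
    connected set Theta.  This is the factorization criterion ([factorizes]),
    from which sufficiency follows ([factorizes_sufficient]).  Conversely,
    sufficiency implies the factorization ([sufficient_factorizes]), and then
    ln p(y) - ln q(T y) is constant along the sequence theta + v / n outside
    one null set, so that its derivative at theta in the direction v is 0
    ([factorizes_gap0]).

    No conditional expectation appears: whenever one would condition on T,
    [ge0_integral_transfer] is used, which says that the integral of k(T) F
    depends on F only through its integrals over the events {T in B}.
    For the matrix inequality, I^-1/2 is obtained as a polynomial in I, by the
    spectral theorem over the complex numbers ([invsqrtmxP]). *)

(** * Integrals that depend only on the events of a statistic *)

Section Transfer.
Import HBNNSimple.
Context {R : realType}.
Local Open Scope ereal_scope.

(** Approximating k by simple functions turns both sides into combinations of
    integrals over the preimages of level sets of k, which agree.  With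
    [T1 = T2] this plays the role of conditioning on a statistic; with
    [T1 = T2 = id] it is the change of density formula. *)
Lemma ge0_integral_transfer d1 d2 dZ (Y1 : measurableType d1)
    (Y2 : measurableType d2) (Z : measurableType dZ)
    (m1 : {measure set Y1 -> \bar R}) (m2 : {measure set Y2 -> \bar R})
    (T1 : Y1 -> Z) (T2 : Y2 -> Z) (F1 : Y1 -> R) (F2 : Y2 -> R) :
  measurable_fun [set: Y1] T1 -> measurable_fun [set: Y2] T2 ->
  measurable_fun [set: Y1] F1 -> measurable_fun [set: Y2] F2 ->
  (forall y, 0 <= F1 y)%R -> (forall y, 0 <= F2 y)%R ->
  (forall B, measurable B -> \int[m1]_(y in T1 @^-1` B) (F1 y)%:E =
                             \int[m2]_(y in T2 @^-1` B) (F2 y)%:E) ->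
  forall k : Z -> R, measurable_fun [set: Z] k -> (forall z, 0 <= k z)%R ->
  \int[m1]_y (k (T1 y) * F1 y)%:E = \int[m2]_y (k (T2 y) * F2 y)%:E.
Proof.
move=> mT1 mT2 mF1 mF2 F10 F20 E k mk k0.
pose K z : \bar R := (k z)%:E.
have mk' : measurable_fun [set: Z] K by exact/measurable_EFinP.
pose k_ := nnsfun_approx measurableT mk'.
have lim d (Y : measurableType d) (m : {measure set Y -> \bar R}) (T : Y -> Z)
    (F : Y -> R) : measurable_fun [set: Y] T -> measurable_fun [set: Y] F ->
    (forall y, 0 <= F y)%R ->
    \int[m]_y (k (T y) * F y)%:E =
    limn (fun n : nat => \sum_(r \in range (k_ n))
      r%:E * \int[m]_(y in T @^-1` (k_ n @^-1` [set r])) (F y)%:E).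
  move=> mT mF F0.
  have mkT n : measurable_fun [set: Y] (k_ n \o T).
    by apply: measurableT_comp => //; exact: measurable_funP.
  transitivity (limn (fun n => \int[m]_y (k_ n (T y) * F y)%:E)).
    rewrite -monotone_convergence//.
    - apply: eq_integral => y _; apply/esym/cvg_lim => //.
      apply/fine_cvgP; split; first exact: nearW.
      have := @cvg_nnsfun_approx _ _ _ _ measurableT _ mk'
        (fun x _ => (k0 x : 0 <= K x)) (T y) I.
      move=> /fine_cvgP[_] kT.
      by apply: cvgMl; exact: kT.
    - by move=> n; apply/measurable_EFinP/measurable_funM => //; exact: mkT.
    - by move=> n y _; rewrite lee_fin mulr_ge0.
    - move=> y _ a b ab; rewrite lee_fin ler_wpM2r//.
      by have /lefP := nd_nnsfun_approx measurableT mk' ab; exact.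
  congr (limn _); apply/funext => n.
  have mA r : measurable (T @^-1` (k_ n @^-1` [set r])).
    by rewrite -[X in measurable X]setTI; apply: mT.
  transitivity (\int[m]_y (\sum_(r \in range (k_ n))
      (r * (\1_(T @^-1` (k_ n @^-1` [set r])) y * F y))%:E)).
    apply: eq_integral => y _; rewrite EFinM fimfunE -fsumEFin//.
    rewrite ge0_mule_fsuml => [|r]; last by rewrite EFinM nnfun_muleindic_ge0.
    by apply: eq_fsbigr => r _; rewrite -EFinM mulrA.
  rewrite ge0_integral_fsum//.
  - apply: eq_fsbigr => r; rewrite inE => -[z _ <-].
    under eq_integral do rewrite EFinM.
    rewrite ge0_integralZl//.
    + rewrite [in RHS]integral_mkcond; congr (_ * _).
      apply: eq_integral => y _; rewrite patchE indicE; case: (y \in _).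
        by rewrite mul1r.
      by rewrite mul0r.
    + apply/measurable_EFinP/measurable_funM => //.
    + by move=> y _; rewrite lee_fin mulr_ge0.
    + by rewrite lee_fin.
  - by move=> r; apply/measurable_EFinP/measurable_funM => //; exact: measurable_funM.
  - move=> r y _; rewrite lee_fin mulrA mulr_ge0//.
    exact: nnfun_muleindic_ge0.
rewrite (lim _ _ m1 T1 F1)// (lim _ _ m2 T2 F2)//.
congr (limn _); apply/funext => n; apply: eq_fsbigr => r _.
by rewrite E.
Qed.

End Transfer.

Section Density.
Context {R : realType}.
Local Open Scope ereal_scope.

(** The positive and negative parts of F have equal integrals over every event
    {T in B}, so [ge0_integral_transfer] applies to them, for the positive and
    for the negative part of k. *)
Lemma integral_comp_eq0 d dZ (Y : measurableType d) (Z : measurableType dZ)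
    (m : {measure set Y -> \bar R}) (T : Y -> Z) (F : Y -> R) (k : Z -> R) :
  measurable_fun [set: Y] T -> m.-integrable [set: Y] (EFin \o F) ->
  (forall B, measurable B -> \int[m]_(y in T @^-1` B) (F y)%:E = 0) ->
  measurable_fun [set: Z] k ->
  m.-integrable [set: Y] (EFin \o (fun y => k (T y) * F y)%R) ->
  \int[m]_y (k (T y) * F y)%:E = 0.
Proof.
move=> mT iF F0 mk ikF.
have mF : measurable_fun [set: Y] F by have /integrableP[/measurable_EFinP] := iF.
have mFp : measurable_fun [set: Y] F^\+%R by exact: measurable_funrpos.
have mFn : measurable_fun [set: Y] F^\-%R by exact: measurable_funrneg.
have mkp : measurable_fun [set: Z] k^\+%R by exact: measurable_funrpos.
have mkn : measurable_fun [set: Z] k^\-%R by exact: measurable_funrneg.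
have iFp := integrable_funrpos measurableT iF.
have iFn := integrable_funrneg measurableT iF.
have FE y : (F^\+%R y - F^\-%R y)%R = F y by rewrite -[in RHS](funrposBneg F).
have kE z : (k^\+%R z - k^\-%R z)%R = k z by rewrite -[in RHS](funrposBneg k).
have E B : measurable B -> \int[m]_(y in T @^-1` B) (F^\+%R y)%:E =
                           \int[m]_(y in T @^-1` B) (F^\-%R y)%:E.
  move=> mB.
  have mTB : measurable (T @^-1` B) by rewrite -[X in measurable X]setTI; apply: mT.
  have ip : m.-integrable (T @^-1` B) (EFin \o F^\+%R) by apply: integrableS iFp.
  have im : m.-integrable (T @^-1` B) (EFin \o F^\-%R) by apply: integrableS iFn.
  have := F0 _ mB; under eq_integral do rewrite -FE EFinB.
  rewrite integralB_EFin// => /eqP.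
  rewrite sube_eq ?add0e; first by move/eqP.
    exact: integrable_fin_num.
  by rewrite fin_num_adde_defl// integrable_fin_num.
have tr := @ge0_integral_transfer _ _ _ _ Y Y Z m m T T _ _ mT mT mFp mFn
   (@funrpos_ge0 _ _ F) (@funrneg_ge0 _ _ F) E.
have Ep := tr _ mkp (@funrpos_ge0 _ _ k).
have En := tr _ mkn (@funrneg_ge0 _ _ k).
have ipn (u : Z -> R) (v : Y -> R) : measurable_fun [set: Z] u ->
    measurable_fun [set: Y] v -> (forall z, `|u z| <= `|k z|)%R ->
    (forall y, `|v y| <= `|F y|)%R ->
    m.-integrable [set: Y] (EFin \o (fun y => u (T y) * v y)%R).
  move=> mu mv uk vF; apply: le_integrable ikF => //.
    by apply/measurable_EFinP/measurable_funM => //; exact: measurableT_comp.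
  by move=> y _; rewrite lee_fin !normrM ler_pM.
have lep (U : Type) (f : U -> R) x : (`|f^\+%R x| <= `|f x|)%R.
  rewrite ger0_norm ?funrpos_ge0// /funrpos ge_max normr_ge0 andbT.
  exact: ler_norm.
have len (U : Type) (f : U -> R) x : (`|f^\-%R x| <= `|f x|)%R.
  rewrite ger0_norm ?funrneg_ge0// /funrneg ge_max normr_ge0 andbT -normrN.
  exact: ler_norm.
rewrite (eq_integral (fun y =>
  ((k^\+%R (T y) * F^\+%R y - k^\+%R (T y) * F^\-%R y)%:E -
  (k^\-%R (T y) * F^\+%R y - k^\-%R (T y) * F^\-%R y)%:E))); last first.
  by move=> y _; rewrite -EFinB -!mulrBr -mulrBl FE kE.
rewrite integralB_EFin//; last 2 first.
- by under [EFin \o _]eq_fun do rewrite EFinB; apply: integrableB => //; apply: ipn.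
- by under [EFin \o _]eq_fun do rewrite EFinB; apply: integrableB => //; apply: ipn.
under eq_integral do rewrite EFinB.
under [X in _ - X]eq_integral do rewrite EFinB.
rewrite !integralB_EFin//; [|exact: ipn..].
rewrite Ep En !subee//; apply: integrable_fin_num => //; exact: ipn.
Qed.

Section density.
Context d (Y : measurableType d) (nu P : {measure set Y -> \bar R}) (f : Y -> R).
Hypotheses (mf : measurable_fun [set: Y] f) (f0 : forall y, (0 <= f y)%R).
Hypothesis Pf : forall A, measurable A -> P A = \int[nu]_(y in A) (f y)%:E.

Lemma ge0_integral_density (k : Y -> R) : measurable_fun [set: Y] k ->
  (forall y, 0 <= k y)%R -> \int[P]_y (k y)%:E = \int[nu]_y (k y * f y)%:E.
Proof.
move=> mk k0.
have := @ge0_integral_transfer _ _ _ _ Y Y Y P nu id id (cst 1%R) f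
  (@measurable_id _ _ _) (@measurable_id _ _ _) (measurable_cst _) mf
  (fun=> ler01) f0 _ k mk k0.
under eq_integral do rewrite mulr1.
apply => B mB; rewrite preimage_id -Pf//.
by rewrite (integral_cst P mB 1) mul1e.
Qed.

Lemma integrable_density (k : Y -> R) : measurable_fun [set: Y] k ->
  P.-integrable [set: Y] (EFin \o k) <->
  nu.-integrable [set: Y] (EFin \o (fun y => k y * f y)%R).
Proof.
move=> mk.
have mkf : measurable_fun [set: Y] (fun y => k y * f y)%R by exact: measurable_funM.
have E : \int[P]_x `|(EFin \o k) x| =
         \int[nu]_x `|(EFin \o (fun y => (k y * f y)%R)) x|.
  rewrite (eq_integral (fun y => (`|k y|)%:E))// ge0_integral_density//; last first.
    exact: measurableT_comp.
  by apply: eq_integral => y _ /=; rewrite normrM (ger0_norm (f0 y)).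
split => /integrableP[_ h]; apply/integrableP.
  by split; [exact/measurable_EFinP|rewrite -E].
by split; [exact/measurable_EFinP|rewrite E].
Qed.

Lemma integral_density (k : Y -> R) : P.-integrable [set: Y] (EFin \o k) ->
  \int[P]_y (k y)%:E = \int[nu]_y (k y * f y)%:E.
Proof.
move=> ik; have /integrableP[/measurable_EFinP mk _] := ik.
have mkp : measurable_fun [set: Y] k^\+%R by exact: measurable_funrpos.
have mkn : measurable_fun [set: Y] k^\-%R by exact: measurable_funrneg.
have ikp := integrable_funrpos measurableT ik.
have ikn := integrable_funrneg measurableT ik.
have kE y : (k^\+%R y - k^\-%R y)%R = k y by rewrite -[in RHS](funrposBneg k).
under eq_integral do rewrite -kE EFinB.
under [RHS]eq_integral do rewrite -kE mulrBl EFinB.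
rewrite !integralB_EFin//; [|exact/integrable_density..].
by rewrite !ge0_integral_density.
Qed.

End density.
End Density.

(** * Directional derivatives and null sets *)

Section Calculus.
Context {R : realType}.

Section normed.
Context {V : normedModType R}.
Implicit Types (x v : V) (F G : V -> R).

Lemma is_derive_ln F x v (l : R) : 0 < F x -> is_derive x v F l ->
  is_derive x v (fun y => ln (F y)) (l / F x).
Proof.
move=> F0 [dF dFl].
(* a directional derivative is a derivative at 0 along the line x + h v *)
have lineP G : derivable G x v <-> derivable (fun h : R => G (h *: v + x)) 0 1.
  exact: derivable1P.
have lineE G : 'D_v G x = 'D_1 (fun h : R => G (h *: v + x)) 0.
  rewrite /derive; congr (lim (_ @ 0^')); apply/funext => h /=.
  by rewrite scale0r add0r addr0 [h *: 1]mulr1.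
have dF1 : is_derive (0 : R) 1 (fun h : R => F (h *: v + x)) l.
  by split; [exact/lineP|rewrite -lineE].
have dl : is_derive (0 : R) 1 (fun h : R => ln (F (h *: v + x))) (l / F x).
  rewrite mulrC; apply: (@is_derive1_comp _ (@ln R)).
  by rewrite scale0r add0r; exact: is_derive1_ln.
by case: dl => d1 d2; split; [exact/lineP|rewrite lineE].
Qed.

Lemma derive0_line F x v (t : R) :
  (forall s, `|s| <= `|t| -> is_derive (s *: v + x) v F 0) ->
  F (t *: v + x) = F x.
Proof.
move=> dF; pose g s := F (s *: v + x).
have dg (s : R) : `|s| <= `|t| -> is_derive s 1 g 0.
  move=> /dF[d1 d2].
  have E : (fun h : R => h^-1 *: ((g \o shift s) (h *: 1) - g s)) =
           (fun h => h^-1 *: ((F \o shift (s *: v + x)) (h *: v) - F (s *: v + x))).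
    by apply/funext => h /=; rewrite /g [h *: 1]mulr1 scalerDl addrA.
  by split; rewrite /derivable /derive E.
suff : g t = g 0 by rewrite /g scale0r add0r.
have cg (a b : R) : (forall s : R, s \in `[a, b] -> `|s| <= `|t|) ->
    {within `[a, b], continuous g}.
  move=> h; apply: derivable_within_continuous => s /h st.
  by have [] := dg _ st.
have [t0|t0] := leP 0 t.
- have st s : s \in `[0, t] -> `|s| <= `|t|.
    by rewrite in_itv/= => /andP[s0 st]; rewrite !ger0_norm.
  have [|c _] := @MVT_segment _ g (fun=> 0) 0 t t0 _ (cg _ _ st).
    by move=> s /subset_itv_oo_cc /st; exact: dg.
  by rewrite mul0r => /eqP; rewrite subr_eq0 => /eqP.
- have st s : s \in `[t, 0] -> `|s| <= `|t|.
    rewrite in_itv/= => /andP[ts s0].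
    by rewrite !ler0_norm// ?lerN2// ltW.
  have [|c _] := @MVT_segment _ g (fun=> 0) t 0 (ltW t0) _ (cg _ _ st).
    by move=> s /subset_itv_oo_cc /st; exact: dg.
  by rewrite mul0r => /eqP; rewrite subr_eq0 => /eqP.
Qed.

(** Constancy along a single sequence tending to [x] in the direction [v] is
    all that countably many null sets can provide; it determines a derivative
    that is known to exist. *)
Lemma is_derive_eq0_seq F x v (l : R) : is_derive x v F l ->
  (\forall n \near \oo, F (n.+1%:R^-1 *: v + x) = F x) -> l = 0.
Proof.
move=> [dF <-] Fx.
have h0 : (n.+1%:R^-1 : R) @[n --> \oo] --> 0^'.
  move=> A A0; have h : \forall n \near \oo, (harmonic n : R) != 0 -> A (harmonic n).
    by apply: (@cvg_harmonic R [set x | x != 0 -> A x]); exact: A0.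
  suff : \forall n \near \oo, A (n.+1%:R^-1 : R) by [].
  by apply: filterS h => n; apply; rewrite /harmonic/= invr_eq0 pnatr_eq0.
pose quotient n := n.+1%:R^-1^-1 *: (F (n.+1%:R^-1 *: v + x) - F x).
apply: (@cvg_unique _ _ (quotient n @[n --> \oo])) => //.
  exact: (cvg_comp _ _ h0 dF).
apply: cvg_near_cst; apply: filterS Fx => n /= Fn.
by rewrite /quotient Fn subrr scaler0.
Qed.

Lemma locally_constant_connected (U : set V) F : open U -> connected U ->
  (forall x, U x -> \forall y \near x, F y = F x) ->
  forall x y, U x -> U y -> F x = F y.
Proof.
move=> oU cU lF x0 y Ux0 Uy.
have nU : U `<=` U^° by move: oU; rewrite openE.
pose B := U `&` [set x | F x = F x0].
suff BU : B = U by have : U y by []; rewrite -BU => -[].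
apply: cU; first by exists x0.
- exists B; last by rewrite /B setIA setIid.
  rewrite openE => x [Ux Fx]; have := lF _ Ux; rewrite Fx => h.
  by apply: filterI => //; exact: nU.
- exists (~` (U `&` [set x | F x != F x0])); last first.
    apply/seteqP; split=> x [Ux Fx]; split => //=.
      by move=> -[_] /=; rewrite Fx eqxx.
    by apply: contrapT => /eqP nF; apply: Fx.
  apply: open_closedC; rewrite openE => x [Ux Fx]; have h := lF _ Ux.
  by apply: filterI; [exact: nU|apply: filterS h => y' /= ->].
Unshelve. all: by end_near. Qed.

(** The union of the exceptional null sets of the points of a countable dense
    set is null; continuity in [x] extends the equation from the dense points
    to the whole of [U]. *)
Lemma ae_zero_on d (Y : measurableType d) (mu : {measure set Y -> \bar R})
    (U : set V) (I : countType) (e : I -> V) (f : V -> Y -> R) :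
  open U -> dense (range e) ->
  (forall y x, U x -> {for x, continuous (f^~ y)}) ->
  (forall x, U x -> {ae mu, forall y, f x y = 0}) ->
  {ae mu, forall y, forall x, U x -> f x y = 0}.
Proof.
move=> oU de cf f0.
have nU : U `<=` U^° by move: oU; rewrite openE.
have : {ae mu, forall y, forall n : nat, forall i,
    unpickle n = Some i -> U (e i) -> f (e i) y = 0}.
  apply: ae_foralln => n.
  case: (@unpickle I n) => [i|]; last by apply: aeW.
  have [Ui|nUi] := pselect (U (e i)); last by apply: aeW => y j [<-].
  by move: (f0 _ Ui); apply: filterS => y h j [<-].
apply: filterS => y h x Ux.
apply: contrapT => /eqP fx.
have := cf y x Ux _ (open_nbhs_nbhs (conj (open_neq (y := 0 : R)) fx)).
rewrite nbhs_simpl /= => nx.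
have [W [[oW Wx] Wf]] : exists W : set V, open_nbhs x W /\
    W `<=` [set z | f z y != 0 /\ U z].
  have : nbhs x [set z | f z y != 0 /\ U z].
    by apply: filterI => //; exact: nU.
  by rewrite nbhsE => -[W ? ?]; exists W.
have [z [Wz [i _ ie]]] := de W (ex_intro _ x Wx) oW.
have [fz Uz] := Wf z Wz.
move/eqP: fz; apply; rewrite -ie; apply: (h (pickle i)); rewrite ?pickleK//.
by rewrite ie.
Qed.

End normed.
End Calculus.

Section ParameterSpaces.
Context {R : realType}.

Lemma locally_constant_line (U : set R) (F : R -> R) : open U ->
  (forall x, U x -> is_derive x 1 F 0) ->
  forall x, U x -> \forall y \near x, F y = F x.
Proof.
rewrite openE => nU dF x /nU /nbhs_ballP[r /= r0 rU].
apply/nbhs_ballP; exists r => //= y xy.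
rewrite -[y](subrK x) -[y - x]mulr1.
apply: derive0_line => s st; apply: dF; apply: rU.
rewrite [s *: 1]mulr1 /ball/= opprD addrCA subrr addr0 normrN.
by apply: le_lt_trans st _; rewrite distrC.
Qed.

(** The ball of the sup norm is a cube, so that its points are reached from the
    centre within the ball by changing one coordinate at a time. *)
Lemma locally_constant_rV k (U : set 'rV[R]_k) (F : 'rV[R]_k -> R) : open U ->
  (forall x j, U x -> is_derive x (delta_mx 0 j) F 0) ->
  forall x, U x -> \forall y \near x, F y = F x.
Proof.
rewrite openE => nU dF x /nU /nbhs_ballP[r /= r0 rU].
apply/nbhs_ballP; exists r => //= y [_ xy].
(* the path from x to y: z n has the first n coordinates of y *)
pose z n : 'rV[R]_k := \row_j (if (j < n)%N then y 0 j else x 0 j).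
have zS (n : 'I_k) : z n.+1 = (y 0 n - x 0 n) *: delta_mx 0 n + z n.
  apply/rowP => j; rewrite !mxE eqxx/= ltnS leq_eqVlt.
  have [->|jn] := eqVneq j n; first by rewrite eqxx ltnn/= mulr1 subrK.
  by rewrite (negbTE (jn : (val j != val n))) mulr0 add0r.
suff zx n : (n <= k)%N -> F (z n) = F x.
  rewrite -(zx k)//; congr F; apply/rowP => j; by rewrite mxE ltn_ord.
elim: n => [_|n ih nk]; first by congr F; apply/rowP => j; rewrite mxE.
transitivity (F (z n)); last exact: ih (ltnW nk).
have /= -> := zS (Ordinal nk).
apply: derive0_line => s st; apply: dF; apply: rU; split => // i j.
rewrite !mxE (ord1 i).
have [->|jn] := eqVneq j (Ordinal nk).
  rewrite eqxx ltnn/= mulr1 /ball/= opprD addrCA subrr addr0 normrN.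
  by apply: le_lt_trans st _; rewrite distrC; exact: xy.
rewrite mulr0 add0r; case: ifP => _; first exact: xy.
exact: ballxx.
Qed.

Lemma dense_rat_rV k : dense (range (map_mx (@ratr R) : 'rV[rat]_k -> 'rV[R]_k)).
Proof.
move=> A [x Ax]; rewrite openE => /(_ _ Ax)/nbhs_ballP[r /= r0 rA].
have h j : {q : rat | `|x 0 j - ratr q| < r}.
  apply: cid.
  have /rat_in_itvoo[q /itvP qre] : x 0 j < x 0 j + r by rewrite ltrDl.
  exists q; rewrite distrC ger0_norm ?subr_ge0 ?qre//.
  by rewrite ltrBlDl qre.
exists (map_mx ratr (\row_j sval (h j))); split; last by exists (\row_j sval (h j)).
apply: rA; split => // i j; rewrite !mxE (ord1 i).
exact: (svalP (h j)).
Qed.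

End ParameterSpaces.

(** * The inverse square root of a positive definite matrix *)

Section InverseSquareRoot.
Import complex.
Context {R : realType}.

Lemma interpolating_poly (h : R -> R) (s : seq R) :
  exists f : {poly R}, forall x, x \in s -> f.[x] = h x.
Proof.
elim: s => [|a s [f fP]]; first by exists 0.
have [as_|as_] := boolP (a \in s).
  by exists f => x; rewrite inE => /predU1P[->|]; exact: fP.
pose w : {poly R} := \prod_(y <- s) ('X - y%:P).
have wa : w.[a] != 0.
  by move: as_; rewrite -root_prod_XsubC.
exists (f + ((h a - f.[a]) / w.[a]) *: w) => x.
rewrite inE !hornerE => /predU1P[->|xs].
  by rewrite divfK// addrC subrK.
have /eqP-> : root w x by rewrite root_prod_XsubC.
by rewrite mulr0 addr0; exact: fP.
Qed.

Lemma trmx_horner_mx n (A : 'M[R]_n.+1) (f : {poly R}) :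
  (horner_mx A f)^T = horner_mx A^T f.
Proof.
elim/poly_ind: f => [|f c ih]; first by rewrite !rmorph0 trmx0.
rewrite !rmorphD !rmorphM /= !horner_mx_X !horner_mx_C linearD/= tr_scalar_mx.
congr (_ + _); rewrite trmx_mul ih.
by apply: comm_mx_horner; exact: comm_mx_refl.
Qed.

(** A real symmetric matrix is unitarily diagonalizable over the complex
    numbers, with real eigenvalues.  Stating this through polynomials in [A]
    keeps the conclusion over the reals. *)
Lemma symmetric_spectrum n (A : 'M[R]_n.+1) : A^T = A ->
  exists2 s : seq R, {in s, forall r, eigenvalue A r} &
    forall f, {in s, forall r, f.[r] = 0} -> horner_mx A f = 0.
Proof.
move=> AT.
pose C : numClosedFieldType := complex.complex R.
pose iota : {rmorphism R -> C} := complex.real_complex R.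
pose Ac : 'M[C]_n.+1 := map_mx iota A.
have Areal : Ac \is a realmx.
  by apply/mxOverP => i j; rewrite mxE; apply/complex.complex_realP; exists (A i j).
have Asym : Ac \is symmetricmx.
  apply/is_hermitianmxP; apply/matrixP => i j; rewrite expr0 scale1r !mxE.
  by rewrite -[in RHS]AT mxE.
have /orthomx_spectralP := symmetric_normalmx Asym Areal.
have := hermitian_spectral_diag_real (realsym_hermsym Asym Areal).
have := spectral_unit Ac.
move: (spectralmx Ac) (spectral_diag Ac) => P D Pu Dreal AE.
have eigD i : exists2 r, D 0 i = iota r & eigenvalue A r.
  have /complex.complex_realP[r Dr] := mxOverP Dreal 0 i.
  have {}Dr : D 0 i = iota r := Dr.
  exists r => //; rewrite eigenvalue_root_char -(fmorph_root iota) map_char_poly.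
  rewrite -eigenvalue_root_char -Dr; apply/eigenvalueP; exists (row i P).
    rewrite -/Ac AE -row_mul !mulmxA mulmxV// mul1mx.
    by rewrite row_mul row_diag_mx -scalemxAl -rowE.
  apply/eqP => P0.
  have := Pu; rewrite -row_free_unit => /row_freeP[Q PQ].
  have := congr1 (row i) PQ; rewrite row_mul P0 mul0mx => /rowP/(_ i)/eqP.
  by rewrite !mxE eqxx eq_sym oner_eq0.
exists [seq Re (D 0 i) | i <- enum 'I_n.+1].
  by move=> _ /mapP[i _ ->]; have [r -> Ar] := eigD i.
move=> f fA; apply: (@map_mx_inj _ _ iota); rewrite map_mx0 map_horner_mx -/Ac AE.
rewrite horner_mx_uconjC// horner_mx_diag.
rewrite (_ : map_mx _ D = 0) ?raddf0 ?mulmx0 ?mul0mx//.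
apply/rowP => i; rewrite !mxE; have [r Dr _] := eigD i.
have := fA (Re (D 0 i)) (map_f _ (mem_enum _ i)).
rewrite Dr /= => fr0.
by rewrite horner_map fr0 rmorph0.
Qed.

Lemma sqmx_gt0 n (u : 'rV[R]_n) : u != 0 -> 0 < (u *m u^T) 0 0.
Proof.
move=> u0; rewrite mxE lt_neqAle; apply/andP; split; last first.
  by apply: sumr_ge0 => i _; rewrite mxE -expr2 sqr_ge0.
apply: contra u0; rewrite eq_sym psumr_eq0 => [/allP h|i _]; last first.
  by rewrite mxE -expr2 sqr_ge0.
apply/eqP/rowP => i; have := h i (mem_index_enum i).
by rewrite /= mxE -expr2 sqrf_eq0 [RHS]mxE => /eqP.
Qed.

Lemma pdmx_unit n (A : 'M[R]_n) : pdmx A -> A \in unitmx.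
Proof.
move=> [_ A0]; rewrite -row_free_unit -kermx_eq0; apply/eqP/row_matrixP => i.
rewrite row0; apply/eqP/negPn/negP => /A0.
by rewrite -row_mul mulmx_ker row0 mul0mx mxE ltxx.
Qed.

(** Take [S = Q ^+ 2], where [Q] is a polynomial in [A] that takes the value
    [r ^ (-1/4)] at each eigenvalue [r]: then [Q ^+ 4 * A = 1] by
    [symmetric_spectrum], and [S] is positive definite as the square of an
    invertible symmetric matrix. *)
Lemma pdmx_sqrt_inv n (A : 'M[R]_n) : pdmx A ->
  exists S, pdmx S /\ S *m S = invmx A.
Proof.
case: n A => [|n] A pdA.
  exists 1%:M; split; last by apply/matrixP => -[].
  by split=> [|u /eqP[]]; [rewrite trmx1|apply/matrixP => i []].
have [AT A0] := pdA.
have ev_gt0 r : eigenvalue A r -> 0 < r.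
  move=> /eigenvalueP[v vA v0]; have := A0 v v0.
  by rewrite vA -scalemxAl mxE pmulr_lgt0// sqmx_gt0.
have [s sA sP] := symmetric_spectrum AT.
have [f fP] := interpolating_poly (fun r => (Num.sqrt (Num.sqrt r))^-1) s.
pose Q := horner_mx A f.
have QT : Q^T = Q by rewrite /Q trmx_horner_mx AT.
have QA : Q * Q * (Q * Q) * A = 1.
  apply/eqP; rewrite -subr_eq0; apply/eqP.
  transitivity (horner_mx A (f * f * (f * f) * 'X - 1)).
    by rewrite rmorphB !rmorphM /= horner_mx_X rmorph1.
  apply: sP => r rs.
  rewrite -polyC1 !(hornerD, hornerN, hornerM, hornerX, hornerC) fP//.
  have r0 := ev_gt0 r (sA r rs).
  set t := Num.sqrt (Num.sqrt r).
  have tr : t * t * (t * t) = r.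
    by rewrite -!expr2 !sqr_sqrtr ?sqrtr_ge0 ?(ltW r0).
  by rewrite -!invfM tr mulVf ?subrr// gt_eqF.
have Qu : Q \in unitmx.
  have /mulmx1_unit[+ _] := QA.
  by rewrite !unitmx_mul => /andP[/andP[]].
exists (Q *m Q); split.
  split=> [|u u0]; first by rewrite trmx_mul QT.
  have -> : u *m (Q *m Q) *m u^T = (u *m Q) *m (u *m Q)^T.
    by rewrite trmx_mul QT !mulmxA.
  apply: sqmx_gt0; apply: contra u0 => /eqP uQ.
  by rewrite -[u](mulmxK Qu) uQ mul0mx.
have Au := pdmx_unit pdA.
by rewrite -[LHS](mulmxK Au) [_ *m A]QA mul1mx.
Qed.

Lemma invsqrtmxP n (A : 'M[R]_n) : pdmx A ->
  pdmx (invsqrtmx A) /\ invsqrtmx A *m invsqrtmx A = invmx A.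
Proof.
move=> /pdmx_sqrt_inv[S hS].
exact: (@xgetPex _ 0 [set S | pdmx S /\ S *m S = invmx A] (ex_intro _ S hS)).
Qed.

End InverseSquareRoot.

(** * The score of a regular model *)

Section RealFunctions.
Context {R : realType} d {Y : measurableType d}.

Lemma measurable_funV_ge0 (f : Y -> R) : measurable_fun [set: Y] f ->
  (forall y, 0 <= f y)%R -> measurable_fun [set: Y] (fun y => (f y)^-1%R).
Proof.
move=> mf f0.
have -> : (fun y => (f y)^-1%R) = (fun y => powR (f y) (-1)).
  by apply/funext => y; rewrite powR_inv1.
exact: (measurableT_comp (measurable_powR (-1)) mf).
Qed.

Lemma restrict_EFin_indic (A : set Y) (g : Y -> R) :
  (fun y => (g y)%:E) \_ A = (fun y => (g y * \1_A y)%:E).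
Proof.
apply/funext => y; rewrite patchE indicE.
by case: (y \in A); rewrite ?mulr1 ?mulr0.
Qed.

End RealFunctions.

(** The score in the direction [v]: [score] is the case [v = 1], and the
    entries of [mscore] are the cases of the basis vectors. *)
Definition dirscore {R : realType} {V : normedModType R} {U : Type}
    (f : V -> U -> R) (v theta : V) (x : U) : R :=
  'D_v (fun t => log_likelihood f t x) theta.

Section RegularModel.
Context {R : realType} {V : normedModType R} d {Y : measurableType d}.
Context (mu : {measure set Y -> \bar R}) (Theta : set V).
Context (P : V -> probability Y R) (f : V -> Y -> R) (S : set Y).
Hypotheses (oTheta : open Theta) (model : regular_model mu Theta P f S).
Implicit Types (theta v : V).

Lemma density_gt0 theta y : Theta theta -> S y -> 0 < f theta y.
Proof. by move=> tT /(density_support model _ tT). Qed.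

Lemma density_eq0 theta y : Theta theta -> ~ S y -> f theta y = 0.
Proof.
move=> tT nS; apply/eqP; rewrite eq_le (density_ge0 model)// andbT leNgt.
by apply/negP => /(density_support model _ tT).
Qed.

Lemma near_param theta : Theta theta -> \forall t \near theta, Theta t.
Proof. by move: oTheta; rewrite openE; exact. Qed.

Lemma density_derivable theta v y : Theta theta -> derivable (f^~ y) theta v.
Proof. by move=> tT; have [h _] := density_smooth model y 1 v; exact: h. Qed.

Lemma density_continuous theta y : Theta theta -> {for theta, continuous (f^~ y)}.
Proof. by move=> tT; exact: (density_smooth model y 0). Qed.

Lemma derive_density_continuous theta v y : Theta theta ->
  {for theta, continuous ('D_v (f^~ y))}.
Proof. by move=> tT; have [_ h] := density_smooth model y 1 v; exact: h. Qed.

Lemma derive_density_eq0 theta v y : Theta theta -> ~ S y ->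
  'D_v (f^~ y) theta = 0.
Proof.
move=> tT nS; rewrite (@near_eq_derive _ _ _ _ (cst 0)) ?derive_cst//.
by near=> t; rewrite density_eq0//; near: t; exact: near_param.
Unshelve. all: by end_near. Qed.

Lemma is_derive_log_likelihood theta v y : Theta theta -> S y ->
  is_derive theta v (fun t => log_likelihood f t y) ('D_v (f^~ y) theta / f theta y).
Proof.
move=> tT Sy; apply: is_derive_ln; first exact: density_gt0.
exact/derivableP/density_derivable.
Qed.

(** Off the support both sides are 0: the log-likelihood is constantly
    [ln 0 = 0] on the open set [Theta], and [0 / 0 = 0]. *)
Lemma dirscoreE theta v y : Theta theta ->
  dirscore f v theta y = 'D_v (f^~ y) theta / f theta y.
Proof.
move=> tT; have [Sy|nS] := pselect (S y).
  by have [_ h] := is_derive_log_likelihood v tT Sy; exact: h.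
rewrite derive_density_eq0// mul0r /dirscore.
rewrite (@near_eq_derive _ _ _ _ (cst 0)) ?derive_cst//.
near=> t; rewrite /log_likelihood density_eq0//; first by rewrite ln0.
by near: t; exact: near_param.
Unshelve. all: by end_near. Qed.

Lemma dirscore_density theta v y : Theta theta ->
  dirscore f v theta y * f theta y = 'D_v (f^~ y) theta.
Proof.
move=> tT; rewrite dirscoreE//; have [Sy|nS] := pselect (S y).
  by rewrite divfK// gt_eqF// density_gt0.
by rewrite derive_density_eq0// !mul0r.
Qed.

Lemma integrable_derive_density theta v : Theta theta ->
  mu.-integrable [set: Y] (EFin \o (fun y => 'D_v (f^~ y) theta)).
Proof. by move=> tT; have [] := density_diff model measurableT v tT. Qed.

Lemma measurable_dirscore theta v : Theta theta ->
  measurable_fun [set: Y] (dirscore f v theta).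
Proof.
move=> tT.
have -> : dirscore f v theta = (fun y => 'D_v (f^~ y) theta * (f theta y)^-1).
  by apply/funext => y; rewrite dirscoreE.
apply: measurable_funM.
  by have /integrableP[/measurable_EFinP] := integrable_derive_density v tT.
apply: measurable_funV_ge0; first exact: (density_measurable model).
by move=> y; exact: (density_ge0 model).
Qed.

Lemma integral_model theta (k : Y -> R) : Theta theta ->
  (P theta).-integrable [set: Y] (EFin \o k) ->
  (\int[P theta]_y (k y)%:E = \int[mu]_y (k y * f theta y)%:E)%E.
Proof.
move=> tT; apply: integral_density.
- exact: (density_measurable model).
- by move=> y; exact: (density_ge0 model).
- by move=> A mA; exact: (densityE model).
Qed.

Lemma ge0_integral_model theta (k : Y -> R) : Theta theta ->
  measurable_fun [set: Y] k -> (forall y, 0 <= k y) ->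
  (\int[P theta]_y (k y)%:E = \int[mu]_y (k y * f theta y)%:E)%E.
Proof.
move=> tT; apply: ge0_integral_density.
- exact: (density_measurable model).
- by move=> y; exact: (density_ge0 model).
- by move=> A mA; exact: (densityE model).
Qed.

Lemma integrable_model theta (k : Y -> R) : Theta theta ->
  measurable_fun [set: Y] k ->
  (P theta).-integrable [set: Y] (EFin \o k) <->
  mu.-integrable [set: Y] (EFin \o (fun y => k y * f theta y)).
Proof.
move=> tT; apply: integrable_density.
- exact: (density_measurable model).
- by move=> y; exact: (density_ge0 model).
- by move=> A mA; exact: (densityE model).
Qed.

Lemma integrable_dirscore theta v : Theta theta ->
  (P theta).-integrable [set: Y] (EFin \o dirscore f v theta).
Proof.
move=> tT; apply/integrable_model => //; first exact: measurable_dirscore.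
under [EFin \o _]eq_fun do rewrite dirscore_density//.
exact: integrable_derive_density.
Qed.

(** The integral of the score times the density is that of the derivative of
    the density, which can be taken out of the integral. *)
Lemma integral_dirscore theta v A : Theta theta -> measurable A ->
  (\int[P theta]_(y in A) (dirscore f v theta y)%:E =
   ('D_v (fun t => fine (P t A)) theta)%:E)%E.
Proof.
move=> tT mA; have [iD [_ DE]] := density_diff model mA v tT.
have -> : 'D_v (fun t => fine (P t A)) theta =
          'D_v (fun t => \int[mu]_(x in A) f t x) theta.
  apply: near_eq_derive; near=> t; rewrite (densityE model)//.
  by near: t; exact: near_param.
rewrite DE.
have mS := measurable_dirscore v tT.
have iS := integrable_dirscore v tT.
rewrite integral_mkcond restrict_EFin_indic.
rewrite integral_model//; last first.
  have := (integrable_mkcond _ mA).1 (integrableS measurableT mA (@subsetT _ _) iS).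
  by rewrite restrict_EFin_indic.
under eq_integral do rewrite mulrAC dirscore_density//.
rewrite /Rintegral fineK; last exact: integrable_fin_num.
by rewrite [RHS]integral_mkcond restrict_EFin_indic.
Unshelve. all: by end_near. Qed.

End RegularModel.

(** * Second moments *)

Section Moments.
Context {R : realType} d {Y : measurableType d} (P : probability Y R).
Implicit Types X W : Y -> R.

Lemma Lfun2_integrableM X W : X \in Lfun P 2%:E -> W \in Lfun P 2%:E ->
  P.-integrable [set: Y] (EFin \o (fun y => X y * W y)).
Proof. by move=> X2 W2; apply/Lfun1_integrable/Lfun2_mul_Lfun1. Qed.

Lemma Lfun2_Lfun1 X : X \in Lfun P 2%:E -> X \in Lfun P 1.
Proof. by apply: Lfun_subset12; exact: fin_num_measure. Qed.

Lemma covariance_centered X W : X \in Lfun P 2%:E -> W \in Lfun P 2%:E ->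
  ('E_P[X] = 0)%E -> fine (covariance P X W) = \int[P]_y (X y * W y).
Proof.
move=> X2 W2 X0.
have XW := Lfun2_mul_Lfun1 X2 W2.
rewrite covarianceE//; [|exact: Lfun2_Lfun1..].
by rewrite X0 mul0e sube0 unlock.
Qed.

(** Bilinear form of Pythagoras' theorem: the hypotheses say that [S1 - G1] is
    orthogonal to [G2], and [S2 - G2] to [G1]. *)
Lemma integral_residualM S1 S2 G1 G2 :
  S1 \in Lfun P 2%:E -> S2 \in Lfun P 2%:E ->
  G1 \in Lfun P 2%:E -> G2 \in Lfun P 2%:E ->
  \int[P]_y (G2 y * S1 y) = \int[P]_y (G2 y * G1 y) ->
  \int[P]_y (G1 y * S2 y) = \int[P]_y (G1 y * G2 y) ->
  \int[P]_y ((S1 y - G1 y) * (S2 y - G2 y)) =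
  \int[P]_y (S1 y * S2 y) - \int[P]_y (G1 y * G2 y).
Proof.
move=> S12 S22 G12 G22 E1 E2.
have iB X W X' W' : X \in Lfun P 2%:E -> W \in Lfun P 2%:E ->
    X' \in Lfun P 2%:E -> W' \in Lfun P 2%:E ->
    P.-integrable [set: Y] (EFin \o (fun y => X y * W y - X' y * W' y)).
  move=> X2 W2 X'2 W'2; under [EFin \o _]eq_fun do rewrite EFinB.
  exact: (integrableB measurableT (Lfun2_integrableM X2 W2)
    (Lfun2_integrableM X'2 W'2)).
have E y : (S1 y - G1 y) * (S2 y - G2 y) =
    (S1 y * S2 y - G2 y * S1 y) - (G1 y * S2 y - G1 y * G2 y) by ring.
under eq_Rintegral do rewrite E.
rewrite (RintegralB measurableT (iB _ _ _ _ S12 S22 G22 S12)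
  (iB _ _ _ _ G12 S22 G12 G22)).
rewrite !RintegralB//; [|exact: Lfun2_integrableM..].
rewrite E1 E2 subrr subr0.
by congr (_ - _); apply: eq_Rintegral => y _; rewrite mulrC.
Qed.

Section distribution.
Context dZ {Z : measurableType dZ} (T : {mfun Y >-> Z}).

Lemma integrable_distribution (k : Z -> R) :
  (distribution P T).-integrable [set: Z] (EFin \o k) ->
  P.-integrable [set: Y] (EFin \o (k \o T)).
Proof.
move=> /integrableP[mk ik]; apply/integrableP; split.
  exact: (measurableT_comp mk (measurable_funPT T)).
by rewrite ge0_integral_distribution// in ik; exact: measurableT_comp.
Qed.

Lemma expectation_distribution (X : Z -> R) : measurable_fun [set: Z] X ->
  X \o T \in Lfun P 1 -> ('E_(distribution P T)[X] = 'E_P[X \o T])%E.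
Proof.
move=> mX /Lfun1_integrable X1.
by rewrite !unlock integral_distribution//; exact/measurable_EFinP.
Qed.

Lemma covariance_distribution (X W : Z -> R) :
  measurable_fun [set: Z] X -> measurable_fun [set: Z] W ->
  X \o T \in Lfun P 2%:E -> W \o T \in Lfun P 2%:E ->
  covariance (distribution P T) X W = covariance P (X \o T) (W \o T).
Proof.
move=> mX mW X2 W2.
rewrite unlock (expectation_distribution mX (Lfun2_Lfun1 X2)).
rewrite (expectation_distribution mW (Lfun2_Lfun1 W2)).
have center U c : U \in Lfun P 2%:E -> (U \- cst c) \in Lfun P 2%:E.
  by move=> U2; rewrite rpredB ?lee1n//= => _; exact: Lfun_cst.
rewrite expectation_distribution//.
  by apply: measurable_funM; exact: measurable_funB.
exact: (Lfun2_mul_Lfun1 (center _ _ X2) (center _ _ W2)).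
Qed.

End distribution.
End Moments.

(** * The marginal score is the projection of the score *)

Section Statistic.
Context {R : realType} {V : normedModType R} d {Y : measurableType d}
  (nu : {measure set Y -> \bar R}) dZ {Z : measurableType dZ}
  (la : {measure set Z -> \bar R}) (Theta : set V)
  (P : V -> probability Y R) (p : V -> Y -> R)
  (T : {mfun Y >-> Z}) (q : V -> Z -> R) (S : set Z).
Hypotheses (oTheta : open Theta)
  (pmodel : regular_model nu Theta P p [set: Y])
  (qmodel : regular_model la Theta (marginal P T) q S).
Implicit Types (theta v w : V).

Definition gap v theta y : R := dirscore p v theta y - dirscore q v theta (T y).

Lemma integrable_marginal_dirscore v theta : Theta theta ->
  (P theta).-integrable [set: Y] (EFin \o (dirscore q v theta \o T)).
Proof.
move=> tT; apply: integrable_distribution.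
exact: (integrable_dirscore oTheta qmodel).
Qed.

Lemma integrable_gap v theta : Theta theta ->
  (P theta).-integrable [set: Y] (EFin \o gap v theta).
Proof.
move=> tT.
rewrite (_ : EFin \o _ = (fun y => (EFin \o dirscore p v theta) y -
    (EFin \o (dirscore q v theta \o T)) y)%E); last by apply/funext.
apply: integrableB => //; first exact: (integrable_dirscore oTheta pmodel).
exact: integrable_marginal_dirscore.
Qed.

(** Both scores integrate to the derivative of the probability of {T in B}. *)
Lemma integral_gap v theta B : Theta theta -> measurable B ->
  (\int[P theta]_(y in T @^-1` B) (gap v theta y)%:E = 0)%E.
Proof.
move=> tT mB; have mTB : measurable (T @^-1` B) by exact: measurable_funPTI.
rewrite integralB_EFin//; last 2 first.
- by apply: integrableS (integrable_dirscore oTheta pmodel _ tT).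
- by apply: integrableS (integrable_marginal_dirscore v tT).
have := integral_dirscore oTheta qmodel v tT mB.
have mq := measurable_dirscore oTheta qmodel v tT.
rewrite integral_pushforward//; last 2 first.
- exact/measurable_EFinP.
- by apply: integrableS (integrable_marginal_dirscore v tT).
move=> /= ->.
rewrite (integral_dirscore oTheta pmodel)//.
by rewrite subee.
Qed.

Lemma gap_orthogonal v theta (k : Z -> R) : Theta theta ->
  measurable_fun [set: Z] k ->
  (P theta).-integrable [set: Y] (EFin \o (fun y => k (T y) * gap v theta y)) ->
  \int[P theta]_y (k (T y) * gap v theta y) = 0.
Proof.
move=> tT mk ik; rewrite /Rintegral (@integral_comp_eq0 _ _ _ _ _ _ T)//.
  exact: integrable_gap.
by move=> B; exact: integral_gap.
Qed.

Section moments.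
Context (theta : V) (tT : Theta theta).
Let L2 := Lfun (P theta) 2%:E.
Let mean0 (X : Y -> R) := ('E_(P theta)[X] = 0)%E.
Let s v := dirscore p v theta.
Let g v := dirscore q v theta \o T.

(** Cov(g, s) = Cov(g, g), since g is a function of T. *)
Lemma score_marginal_score v w : s v \in L2 -> g v \in L2 -> g w \in L2 ->
  \int[P theta]_y (g w y * s v y) = \int[P theta]_y (g w y * g v y).
Proof.
move=> sv gv gw; apply/eqP; rewrite -subr_eq0 -RintegralB//.
- under eq_Rintegral do rewrite -mulrBr.
  apply/eqP/gap_orthogonal => //; first exact: (measurable_dirscore oTheta qmodel).
  under [EFin \o _]eq_fun do rewrite mulrBr EFinB.
  by apply: integrableB => //; exact: Lfun2_integrableM.
- exact: Lfun2_integrableM.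
- exact: Lfun2_integrableM.
Qed.

Lemma marginal_covariance v w : g v \in L2 -> g w \in L2 -> mean0 (g v) ->
  fine (covariance (marginal P T theta)
    (dirscore q v theta) (dirscore q w theta)) =
  \int[P theta]_y (g v y * g w y).
Proof.
move=> gv gw gv0; rewrite /marginal covariance_distribution//.
- exact: covariance_centered.
- exact: (measurable_dirscore oTheta qmodel).
- exact: (measurable_dirscore oTheta qmodel).
Qed.

Lemma integral_gap_gap v w :
  s v \in L2 -> s w \in L2 -> g v \in L2 -> g w \in L2 ->
  \int[P theta]_y (gap v theta y * gap w theta y) =
  \int[P theta]_y (s v y * s w y) - \int[P theta]_y (g v y * g w y).
Proof.
move=> sv sw gv gw.
exact: (integral_residualM sv sw gv gw (score_marginal_score sv gv gw)
  (score_marginal_score sw gw gv)).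
Qed.

End moments.
End Statistic.

(** * Sufficiency and the factorization criterion *)

Section ConditionalProbability.
Context {R : realType} d {Y : measurableType d} dZ {Z : measurableType dZ}
  (P : probability Y R) (T : {mfun Y >-> Z}) (A : set Y) (mA : measurable A).

Definition trace_distribution : set Z -> \bar R := pushforward (mrestr P mA) T.

Let trace_distribution0 : trace_distribution set0 = 0%E.
Proof. exact: measure0. Qed.

Let trace_distribution_ge0 B : (0 <= trace_distribution B)%E.
Proof. exact: measure_ge0. Qed.

Let trace_distribution_sigma_additive : semi_sigma_additive trace_distribution.
Proof. exact: measure_semi_sigma_additive. Qed.

HB.instance Definition _ := isMeasure.Build _ _ _ trace_distribution
  trace_distribution0 trace_distribution_ge0 trace_distribution_sigma_additive.

Let trace_distribution_finite : fin_num_fun trace_distribution.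
Proof.
move=> B mB; rewrite /trace_distribution /pushforward /mrestr.
by apply: fin_num_measure; apply: measurableI => //; exact: measurable_funPTI.
Qed.

HB.instance Definition _ := Measure_isFinite.Build _ _ _ trace_distribution
  trace_distribution_finite.

(** P(A | T), as the Radon-Nikodym derivative of B |-> P(A, T in B) with
    respect to the distribution of T. *)
Lemma conditional_probability_exists : exists kappa : Z -> R,
  [/\ measurable_fun [set: Z] kappa, forall z, 0 <= kappa z &
   forall B, measurable B -> P (A `&` T @^-1` B) =
     (\int[P]_(y in T @^-1` B) (kappa (T y))%:E)%E].
Proof.
have dom : trace_distribution `<< distribution P T.
  apply/null_content_dominatesP => B mB PB; apply/eqP.
  rewrite -measure_le0 -[leRHS]PB.
  apply: le_measure; rewrite ?inE; [|exact: measurable_funPTI|by move=> y []].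
  by apply: measurableI => //; exact: measurable_funPTI.
pose K := Radon_Nikodym_SigmaFinite.f trace_distribution (distribution P T).
have K0 := Radon_Nikodym_SigmaFinite.f_ge0 dom.
have Kfin := Radon_Nikodym_SigmaFinite.f_fin_num dom.
have /integrableP[mK _] := Radon_Nikodym_SigmaFinite.f_integrable dom.
exists (fine \o K); split.
- exact: measurableT_comp.
- by move=> z /=; apply: fine_ge0; exact: K0.
- move=> B mB; transitivity (trace_distribution B).
    by rewrite /trace_distribution /pushforward /mrestr setIC.
  have := Radon_Nikodym_SigmaFinite.f_integral dom mB.
  rewrite ge0_integral_pushforward//; last exact: measurable_funTS.
  move=> ->.
  by apply: eq_integral => y _ /=; rewrite fineK.
Qed.

(** The set where T falls in {kappa < 0} does not meet A, up to a null set,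
    because the integral of kappa(T) over it is at most 0.  So a version of
    the conditional probability may be taken to be nonnegative everywhere, as
    [ge0_integral_transfer] requires. *)
Lemma conditional_probability_pos (kappa : Z -> R) :
  measurable_fun [set: Z] kappa ->
  (forall B, measurable B -> P (A `&` T @^-1` B) =
     (\int[P]_(y in T @^-1` B) (kappa (T y))%:E)%E) ->
  forall B, measurable B -> P (A `&` T @^-1` B) =
     (\int[P]_(y in T @^-1` B) (kappa^\+ (T y))%:E)%E.
Proof.
move=> mk kE B mB.
pose N := [set z | kappa z < 0].
have mN : measurable N.
  rewrite [N](_ : _ = kappa @^-1` `]-oo, 0[).
    by rewrite -[X in measurable X]setTI; exact: mk.
  by apply/seteqP; split => z /=; rewrite in_itv.
have mBN : measurable (B `&` N) by exact: measurableI.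
have mBD : measurable (B `\` N) by exact: measurableD.
have PN : P (A `&` T @^-1` (B `&` N)) = 0%E.
  apply/eqP; rewrite eq_le measure_ge0 andbT kE//.
  under eq_integral do rewrite -[kappa _]opprK EFinN.
  have k0 y : (T @^-1` (B `&` N)) y -> (0 <= (- kappa (T y))%:E)%E.
    by move=> [_ /ltW]; rewrite lee_fin oppr_ge0.
  by rewrite integral_ge0N// oppe_le0 integral_ge0.
transitivity (P (A `&` T @^-1` (B `\` N))).
  have -> : A `&` T @^-1` B =
      (A `&` T @^-1` (B `\` N)) `|` (A `&` T @^-1` (B `&` N)).
    by rewrite -setIUr -preimage_setU -setDDr setDv setD0.
  rewrite measureU; last 3 first.
  - by apply: measurableI => //; exact: measurable_funPTI.
  - by apply: measurableI => //; exact: measurable_funPTI.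
  - by apply/seteqP; split => // y [[_ [_ nN]] [_ [_ ]]].
  by rewrite -[RHS]adde0; congr (_ + _)%E; exact: PN.
rewrite kE// integral_mkcond [RHS]integral_mkcond.
apply: eq_integral => y _; rewrite !patchE.
have [Ty|nTy] := boolP (y \in T @^-1` B); last first.
  by rewrite ifF//; apply: contraNF nTy; rewrite !inE => -[].
have [/= kN|kP] := ltP (kappa (T y)) 0.
  rewrite memNset; last by case.
  by rewrite /funrpos max_r// ltW.
rewrite mem_set; last first.
  by split; [move: Ty; rewrite inE|rewrite /N/=; apply/negP; rewrite -leNgt].
by rewrite /funrpos max_l.
Qed.

End ConditionalProbability.

Section Sufficiency.
Context {R : realType} {V : normedModType R} d {Y : measurableType d}
  (nu : {measure set Y -> \bar R}) dZ {Z : measurableType dZ}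
  (la : {measure set Z -> \bar R}) (Theta : set V)
  (P : V -> probability Y R) (p : V -> Y -> R)
  (T : {mfun Y >-> Z}) (q : V -> Z -> R) (S : set Z).
Hypotheses
  (pmodel : regular_model nu Theta P p [set: Y])
  (qmodel : regular_model la Theta (marginal P T) q S)
  (ST : forall y, S (T y)).
Implicit Types (s t theta v : V).

(** The likelihood ratio p t / p s is the ratio q t / q s of marginal densities
    at T, written without division. *)
Definition factorizes := forall s t, Theta s -> Theta t ->
  {ae nu, forall y, p t y * q s (T y) = p s y * q t (T y)}.

Let p_gt0 t y : Theta t -> 0 < p t y.
Proof. by move=> tT; exact: (density_gt0 pmodel). Qed.

Let q_gt0 t y : Theta t -> 0 < q t (T y).
Proof. by move=> tT; exact: (density_gt0 qmodel). Qed.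

Let mp t : Theta t -> measurable_fun [set: Y] (p t).
Proof. exact: (density_measurable pmodel). Qed.

Let mq t : Theta t -> measurable_fun [set: Z] (q t).
Proof. exact: (density_measurable qmodel). Qed.

Definition marginal_ratio s t z : R := q t z / q s z.

Lemma marginal_ratio_ge0 s t z : Theta s -> Theta t -> 0 <= marginal_ratio s t z.
Proof. by move=> sT tT; rewrite divr_ge0// (density_ge0 qmodel). Qed.

Lemma measurable_marginal_ratio s t : Theta s -> Theta t ->
  measurable_fun [set: Z] (marginal_ratio s t).
Proof.
move=> sT tT; apply: measurable_funM; first exact: mq.
apply: measurable_funV_ge0; first exact: mq.
by move=> z; exact: (density_ge0 qmodel).
Qed.

Lemma marginal_ratioK s t z : Theta s -> Theta t ->
  marginal_ratio s t z * q s z = q t z.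
Proof.
move=> sT tT; rewrite /marginal_ratio; have [Sz|nS] := pselect (S z).
  by rewrite divfK// gt_eqF// (density_gt0 qmodel).
by rewrite !(density_eq0 qmodel)// !mul0r.
Qed.

Let mT : measurable_fun [set: Y] T. Proof. exact: measurable_funPT. Qed.

(** Under the factorization, [P t] has density [marginal_ratio s t \o T] with
    respect to [P s], a function of T. *)
Lemma change_parameter s t (W : Y -> R) : factorizes -> Theta s -> Theta t ->
  measurable_fun [set: Y] W -> (forall y, 0 <= W y) ->
  (\int[P s]_y (marginal_ratio s t (T y) * W y)%:E = \int[P t]_y (W y)%:E)%E.
Proof.
move=> F sT tT mW W0.
have mr : measurable_fun [set: Y] (marginal_ratio s t \o T).
  by apply: measurableT_comp => //; exact: measurable_marginal_ratio.
have r0 y := marginal_ratio_ge0 (T y) sT tT.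
rewrite (ge0_integral_model pmodel sT)//; last 2 first.
- exact: measurable_funM.
- by move=> y; rewrite mulr_ge0.
rewrite (ge0_integral_model pmodel tT)//.
apply: ge0_ae_eq_integral => //.
- apply/measurable_EFinP; apply: measurable_funM; last exact: mp.
  exact: measurable_funM.
- by apply/measurable_EFinP; apply: measurable_funM => //; exact: mp.
- move=> y _; rewrite lee_fin.
  by apply: mulr_ge0 (ltW (p_gt0 y sT)); exact: mulr_ge0.
- by move=> y _; rewrite lee_fin; exact: mulr_ge0 (W0 y) (ltW (p_gt0 y tT)).
- move: (F s t sT tT); apply: filterS => y Fy _; congr EFin.
  have qs0 : q s (T y) != 0 by rewrite gt_eqF// q_gt0.
  rewrite /marginal_ratio.
  have -> : p t y = p s y * q t (T y) / q s (T y) by rewrite -Fy mulfK.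
  by field.
Qed.

(** A version [kappa] of P s (A | T) at one parameter [s] serves at every
    parameter [t]: by [change_parameter], passing from [P s] to [P t]
    multiplies by a function of T, and [ge0_integral_transfer] replaces the
    indicator of A by [kappa \o T] in any integral against such a function. *)
Lemma factorizes_sufficient : factorizes -> sufficient Theta P T.
Proof.
move=> F A mA.
have [[s sT]|Theta0] := pselect (exists s, Theta s); last first.
  exists (cst 0) => // t B tT; case: Theta0; by exists t.
have [kappa [mk k0 kE]] := conditional_probability_exists (P s) T mA.
exists kappa => // t B tT mB.
have mTB C : measurable C -> measurable (T @^-1` C) by exact: measurable_funPTI.
have mAB := measurableI _ _ mA (mTB _ mB).
pose k z := marginal_ratio s t z * \1_B z.
have mk' : measurable_fun [set: Z] k.
  by apply: measurable_funM => //; exact: measurable_marginal_ratio.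
have k'0 z : 0 <= k z by rewrite mulr_ge0// marginal_ratio_ge0.
have mkT : measurable_fun [set: Y] (kappa \o T) by exact: measurableT_comp.
have mindic d' (U : measurableType d') (C : set U) : measurable C ->
    measurable_fun [set: U] (\1_C : U -> R).
  by move=> mC; exact: measurable_indic.
have := @ge0_integral_transfer R _ _ _ Y Y Z (P s) (P s) T T (\1_A) (kappa \o T)
  mT mT (mindic _ _ _ mA) mkT (fun=> ler0n _ _) (fun y => k0 (T y)) _ k mk' k'0.
have E C : measurable C -> (\int[P s]_(y in T @^-1` C) (\1_A y)%:E =
    \int[P s]_(y in T @^-1` C) ((kappa \o T) y)%:E)%E.
  by move=> mC; rewrite integral_indic//; [exact: kE|exact: mTB].
move=> /(_ E).
have -> : (\int[P s]_y (k (T y) * \1_A y)%:E = P t (A `&` T @^-1` B))%E.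
  transitivity (\int[P t]_y (\1_(A `&` T @^-1` B) y)%:E)%E; last first.
    by rewrite integral_indic// setIT.
  rewrite -(change_parameter F sT tT); last 2 first.
  - exact: mindic.
  - by move=> y; rewrite indicE.
  apply: eq_integral => y _; congr EFin; rewrite /k -mulrA; congr (_ * _).
  by rewrite indicI mulrC.
move=> ->.
transitivity (\int[P t]_y (\1_B (T y) * kappa (T y))%:E)%E.
  rewrite -(change_parameter F sT tT)//.
  - by apply: eq_integral => y _; rewrite /k/= mulrA.
  - apply: measurable_funM => //.
    exact: (measurableT_comp (mindic _ _ _ mB) mT).
  - by move=> y; rewrite mulr_ge0.
rewrite [RHS]integral_mkcond; apply: eq_integral => y _.
rewrite patchE/= indicE.
have -> : (T y \in B) = (y \in T @^-1` B) by apply/idP/idP; rewrite !inE.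
by case: ifP => _; rewrite ?mul1r ?mul0r.
Qed.

(** Both sides of the factorization, divided by [q s (T y)], are densities of
    [P t]: replacing the indicator of A by [k \o T] under [P s] moves the
    integral to the marginal model, where [marginal_ratio s t] changes the
    parameter to [t], and back to [P t], since [k] serves at [t] too. *)
Lemma sufficient_factorizes : sufficient Theta P T -> factorizes.
Proof.
move=> suf s t sT tT.
have mr : measurable_fun [set: Y] (marginal_ratio s t \o T).
  by apply: measurableT_comp => //; exact: measurable_marginal_ratio.
have r0 z := marginal_ratio_ge0 z sT tT.
have mindic d' (U : measurableType d') (C : set U) : measurable C ->
    measurable_fun [set: U] (\1_C : U -> R).
  by move=> mC; exact: measurable_indic.
have key A : measurable A ->
    (\int[nu]_(y in A) (marginal_ratio s t (T y) * p s y)%:E = P t A)%E.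
  move=> mA; have [kappa mk kE] := suf A mA.
  have kE' th (thT : Theta th) :=
    conditional_probability_pos mA mk (fun B => kE th B thT).
  pose k := kappa^\+.
  have mkp : measurable_fun [set: Z] k by exact: measurable_funrpos.
  have k0 z : 0 <= k z by exact: funrpos_ge0.
  have mkT : measurable_fun [set: Y] (k \o T) by exact: measurableT_comp.
  have E C : measurable C -> (\int[P s]_(y in T @^-1` C) (\1_A y)%:E =
      \int[P s]_(y in T @^-1` C) ((k \o T) y)%:E)%E.
    move=> mC; rewrite integral_indic//; last exact: measurable_funPTI.
    exact: (kE' s sT C mC).
  have H := @ge0_integral_transfer R _ _ _ Y Y Z (P s) (P s) T T (\1_A) (k \o T)
    mT mT (mindic _ _ _ mA) mkT (fun=> ler0n _ _) (fun y => k0 (T y)) E _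
    (measurable_marginal_ratio sT tT) r0.
  transitivity (\int[P s]_y (marginal_ratio s t (T y) * \1_A y)%:E)%E.
    rewrite (ge0_integral_model pmodel sT)//; last 2 first.
    - by apply: measurable_funM => //; exact: mindic.
    - by move=> y; rewrite mulr_ge0// indicE.
    rewrite integral_mkcond restrict_EFin_indic.
    by apply: eq_integral => y _; rewrite mulrAC.
  rewrite H.
  transitivity (\int[marginal P T s]_z (marginal_ratio s t z * k z)%:E)%E.
    rewrite ge0_integral_distribution//.
    - apply/measurable_EFinP; apply: measurable_funM => //.
      exact: measurable_marginal_ratio.
    - by move=> z; rewrite lee_fin mulr_ge0.
  transitivity (\int[marginal P T t]_z (k z)%:E)%E.
    rewrite (ge0_integral_model qmodel sT)//; last 2 first.
    - by apply: measurable_funM => //; exact: measurable_marginal_ratio.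
    - by move=> z; rewrite mulr_ge0.
    rewrite (ge0_integral_model qmodel tT)//.
    by apply: eq_integral => z _; rewrite mulrAC marginal_ratioK// mulrC.
  rewrite ge0_integral_distribution//; last exact/measurable_EFinP.
  by have := kE' t tT setT measurableT; rewrite preimage_setT setIT => ->.
have mps := mp sT; have mpt := mp tT.
have ip : nu.-integrable [set: Y] (EFin \o p t).
  apply/integrableP; split; first exact/measurable_EFinP.
  rewrite (eq_integral (fun y => (p t y)%:E)); last first.
    by move=> y _; rewrite gee0_abs// lee_fin ltW// p_gt0.
  by rewrite -(densityE pmodel)// probability_setT ltry.
have : ae_eq nu [set: Y] (EFin \o p t)
    (EFin \o (fun y => marginal_ratio s t (T y) * p s y)).
  apply: integral_ae_eq => //.
    by apply/measurable_EFinP; exact: measurable_funM.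
  by move=> A _ mA; rewrite key// (densityE pmodel).
apply: filterS => y /(_ I)[->].
have qs0 : q s (T y) != 0 by rewrite gt_eqF// q_gt0.
by rewrite /marginal_ratio; field.
Qed.

End Sufficiency.

(** * Sufficiency as equality of the scores *)

Section ScoreGap.
Context {R : realType} {V : normedModType R} d {Y : measurableType d}
  (nu : {measure set Y -> \bar R}) dZ {Z : measurableType dZ}
  (la : {measure set Z -> \bar R}) (Theta : set V)
  (P : V -> probability Y R) (p : V -> Y -> R)
  (T : {mfun Y >-> Z}) (q : V -> Z -> R) (S : set Z).
Hypotheses (oTheta : open Theta)
  (pmodel : regular_model nu Theta P p [set: Y])
  (qmodel : regular_model la Theta (marginal P T) q S)
  (ST : forall y, S (T y)).
Implicit Types (s t theta v : V).

Let p_gt0 t y : Theta t -> 0 < p t y.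
Proof. by move=> tT; exact: (density_gt0 pmodel). Qed.

Let q_gt0 t y : Theta t -> 0 < q t (T y).
Proof. by move=> tT; exact: (density_gt0 qmodel). Qed.

Definition log_density_ratio y t : R := ln (p t y) - ln (q t (T y)).

Lemma is_derive_log_density_ratio theta v y : Theta theta ->
  is_derive theta v (log_density_ratio y) (gap p T q v theta y).
Proof.
move=> tT; rewrite /gap (dirscoreE oTheta pmodel)// (dirscoreE oTheta qmodel)//.
apply: is_deriveB.
  exact: (is_derive_log_likelihood pmodel).
exact: (is_derive_log_likelihood qmodel).
Qed.

Lemma log_density_ratio_eq s t y : Theta s -> Theta t ->
  (log_density_ratio y s = log_density_ratio y t) <->
  (p t y * q s (T y) = p s y * q t (T y)).
Proof.
move=> sT tT; have [ps pt] := (p_gt0 y sT, p_gt0 y tT).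
have [qs qt] := (q_gt0 y sT, q_gt0 y tT).
split.
  rewrite /log_density_ratio => E; apply: ln_inj; rewrite ?posrE ?mulr_gt0//.
  by rewrite !lnM ?posrE//; lra.
move=> /(congr1 (@ln R)); rewrite !lnM ?posrE// /log_density_ratio; lra.
Qed.

(** The points theta + v / n involve only countably many null sets. *)
Lemma factorizes_gap0 theta v : factorizes nu Theta p T q -> Theta theta ->
  {ae nu, forall y, gap p T q v theta y = 0}.
Proof.
move=> F tT; pose u n : V := n.+1%:R^-1 *: v + theta.
have : {ae nu, forall y, forall n, Theta (u n) ->
    p (u n) y * q theta (T y) = p theta y * q (u n) (T y)}.
  apply: ae_foralln => n; have [un|nun] := pselect (Theta (u n)); last exact: aeW.
  by move: (F theta (u n) tT un); apply: filterS => y h _.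
apply: filterS => y h.
apply: (is_derive_eq0_seq (is_derive_log_density_ratio v y tT)).
have uT : u n @[n --> \oo] --> theta.
  rewrite -[X in _ --> X]add0r -(scale0r v); apply: cvgD; last exact: cvg_cst.
  by apply: cvgZr_tmp; exact: cvg_harmonic.
have : \forall n \near \oo, Theta (u n) by apply: uT; exact: near_param.
apply: filterS => n un; apply/(log_density_ratio_eq _ un tT).
by rewrite -h.
Qed.

(* The scores are only considered in the directions [e j]; the two examples are
   the real line with the direction 1, and row vectors with the standard
   basis. *)
Section directions.
Context (J : countType) (e : J -> V) (I : countType) (rat_point : I -> V).
Hypothesis rat_dense : dense (range rat_point).
Hypothesis directions_span : forall F : V -> R,
  (forall x j, Theta x -> is_derive x (e j) F 0) ->
  forall x, Theta x -> \forall y \near x, F y = F x.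

(** The equation gap = 0 is used in the form G = 0, cleared of denominators,
    since G is visibly continuous in the parameter. *)
Lemma gap0_factorizes : connected Theta ->
  (forall theta j, Theta theta ->
     {ae nu, forall y, gap p T q (e j) theta y = 0}) ->
  factorizes nu Theta p T q.
Proof.
move=> cTheta gap0 s t sT tT.
pose G j theta y := 'D_(e j) (p^~ y) theta * q theta (T y) -
                    'D_(e j) (q^~ (T y)) theta * p theta y.
have gapG j theta y : Theta theta ->
    gap p T q (e j) theta y = 0 <-> G j theta y = 0.
  move=> thT; have [pt qt] := (p_gt0 y thT, q_gt0 y thT).
  rewrite /gap (dirscoreE oTheta pmodel)// (dirscoreE oTheta qmodel)// /G.
  set a := 'D_(e j) _ _; set b := 'D_(e j) _ _.
  have [p0 q0] := (lt0r_neq0 pt, lt0r_neq0 qt).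
  split=> /eqP; rewrite subr_eq0.
    by rewrite eqr_div// => /eqP ->; rewrite subrr.
  by rewrite -eqr_div// => /eqP ->; rewrite subrr.
have : {ae nu, forall y, forall n : nat, forall j, unpickle n = Some j ->
    forall theta, Theta theta -> G j theta y = 0}.
  apply: ae_foralln => n; case: (@unpickle J n) => [j|]; last exact: aeW.
  have : {ae nu, forall y, forall theta, Theta theta -> G j theta y = 0}.
    apply: (ae_zero_on oTheta rat_dense) => [y theta thT|theta thT].
      apply: cvgB; apply: cvgM.
      - exact: (derive_density_continuous pmodel).
      - exact: (density_continuous qmodel).
      - exact: (derive_density_continuous qmodel).
      - exact: (density_continuous pmodel).
    by move: (gap0 theta j thT); apply: filterS => y /gapG; exact.
  by apply: filterS => y h _ [<-].
apply: filterS => y h; apply/(log_density_ratio_eq _ sT tT).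
apply: (locally_constant_connected oTheta cTheta) => //.
apply: directions_span => theta j thT.
have <- : gap p T q (e j) theta y = 0.
  by apply/gapG => //; apply: (h (pickle j)); rewrite ?pickleK.
exact: is_derive_log_density_ratio.
Qed.

Lemma gap0_sufficient : connected Theta ->
  (forall theta j, Theta theta ->
     {ae nu, forall y, gap p T q (e j) theta y = 0})
  <-> sufficient Theta P T.
Proof.
move=> cTheta; split=> [gap0|suf theta j thT].
  by apply: (factorizes_sufficient pmodel qmodel) => //; exact: gap0_factorizes.
apply: factorizes_gap0 => //.
exact: (sufficient_factorizes pmodel qmodel).
Qed.

End directions.
End ScoreGap.

Section GapMoments.
Context {R : realType} {V : normedModType R} d {Y : measurableType d}
  (nu : {measure set Y -> \bar R}) dZ {Z : measurableType dZ}
  (Theta : set V) (P : V -> probability Y R) (p : V -> Y -> R)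
  (T : {mfun Y >-> Z}) (q : V -> Z -> R).
Hypothesis pmodel : regular_model nu Theta P p [set: Y].
Context (theta : V) (thT : Theta theta).
Let L2 := Lfun (P theta) 2%:E.
Local Notation s v := (dirscore p v theta).
Local Notation g v := (dirscore q v theta \o T).
Local Notation D v := (gap p T q v theta).

Lemma gap_Lfun2 v : s v \in L2 -> g v \in L2 -> D v \in L2.
Proof.
by move=> sv gv; rewrite -[D v]/(s v \- g v) rpredB ?lee1n.
Qed.

Lemma integral_gap_eq0 v (X : Y -> R) : D v \in L2 -> X \in L2 ->
  {ae nu, forall y, D v y = 0} -> \int[P theta]_y (D v y * X y) = 0.
Proof.
move=> Dv X2 Dv0; rewrite /Rintegral.
have iX := Lfun2_integrableM Dv X2.
rewrite (integral_model pmodel thT iX).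
rewrite (ae_eq_integral (cst 0%E)) ?integral_cst ?mul0e//.
  apply/measurable_EFinP; apply: measurable_funM.
    by have /integrableP[/measurable_EFinP] := iX.
  exact: (density_measurable pmodel).
by move: Dv0; apply: filterS => y -> _; rewrite !mul0r.
Qed.

Lemma gap_sqr_eq0 v : D v \in L2 ->
  \int[P theta]_y (D v y * D v y) = 0 -> {ae nu, forall y, D v y = 0}.
Proof.
move=> Dv; have iD := Lfun2_integrableM Dv Dv.
move=> E0; have D0 : (\int[nu]_y (D v y * D v y * p theta y)%:E = 0)%E.
  rewrite -(integral_model pmodel thT iD) -[LHS]fineK.
    by congr EFin.
  exact: integrable_fin_num.
have mD : measurable_fun [set: Y] (fun y => D v y * D v y * p theta y).
  apply: measurable_funM.
    by have /integrableP[/measurable_EFinP] := iD.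
  exact: (density_measurable pmodel).
have : ae_eq nu [set: Y] (EFin \o (fun y => D v y * D v y * p theta y)) (cst 0%E).
  apply/ae_eq_integral_abs => //; first exact/measurable_EFinP.
  rewrite -D0; apply: eq_integral => y _.
  rewrite gee0_abs// lee_fin mulr_ge0 -?expr2 ?sqr_ge0//.
  exact: (density_ge0 pmodel).
apply: filterS => y hy.
have /eqP : D v y * D v y * p theta y = 0 by have [] := hy I.
rewrite mulf_eq0 -expr2 sqrf_eq0 => /orP[/eqP -> //|].
by rewrite gt_eqF// (density_gt0 pmodel).
Qed.

Lemma gap_sqr_ge0 v : 0 <= \int[P theta]_y (D v y * D v y).
Proof. by apply: Rintegral_ge0 => y _; rewrite -expr2 sqr_ge0. Qed.

End GapMoments.

(** * Scalar parameter *)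

Section ScalarParameter.
Context {R : realType}.

Lemma score_dirscore (U : Type) (f : R -> U -> R) theta :
  score f theta = dirscore f 1 theta.
Proof. by apply/funext => y; rewrite /score derive1E. Qed.

Context d {Y : measurableType d} (nu : {measure set Y -> \bar R})
  (Theta : set R) (P : R -> probability Y R) (p : R -> Y -> R)
  dZ {Z : measurableType dZ} (T : {mfun Y >-> Z})
  (la : {measure set Z -> \bar R}) (q : R -> Z -> R) (S : set Z).
Hypotheses (oTheta : open Theta)
  (pmodel : regular_model nu Theta P p [set: Y])
  (qmodel : regular_model la Theta (marginal P T) q S).
Let g : R -> Y -> R := score (fun theta y => q theta (T y)).
Hypotheses (p_ge : generalized_estimator Theta P (score p))
  (g_ge : generalized_estimator Theta P g).

(** The derivative of the integral of [h t y * p t y], which is constantly 0, is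
    the integral of h' p + h p', and p' is the score times p. *)
Lemma expectation_derive1 theta (h : R -> Y -> R) :
  generalized_estimator Theta P h -> Theta theta ->
  diff_under_integral nu setT Theta (fun t y => h t y * p t y) ->
  fine 'E_(P theta)[fun y => derive1 (h^~ y) theta] =
  - \int[P theta]_y (h theta y * score p theta y).
Proof.
move=> h_ge thT dui.
pose k y : R := derive1 (h^~ y) theta + h theta y * score p theta y.
have p0 y : 0 < p theta y by exact: (density_gt0 pmodel).
have product_rule (a b c e : R) : c * (a * e) + e * b = (b + c * a) * e by ring.
have Dhp y : 'D_1 (fun t => h t y * p t y) theta = k y * p theta y.
  have dh : derivable (h^~ y) theta 1.
    by have [hd _] := ge_smooth h_ge y 1 1; exact: hd.
  have dp : derivable (p^~ y) theta 1 by exact: (density_derivable pmodel).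
  have sp := dirscore_density oTheta pmodel 1 y thT.
  transitivity (h theta y * 'D_(1 : R) (p^~ y) theta +
                p theta y * 'D_(1 : R) (h^~ y) theta).
    exact: (deriveM dh dp).
  rewrite -sp /k derive1E score_dirscore.
  exact: product_rule.
have [iD [_ DE]] := dui theta 1 thT.
have Z0 : \int[nu]_y 'D_1 (fun t => h t y * p t y) theta = 0.
  rewrite -DE (@near_eq_derive _ _ _ _ (cst 0)) ?derive_cst//.
  near=> t; have tT : Theta t by near: t; exact: (near_param oTheta thT).
  have h1 : (P t).-integrable [set: Y] (EFin \o h t).
    by apply/Lfun1_integrable/Lfun2_Lfun1; exact: (ge_sqr_integrable h_ge).
  rewrite /Rintegral -(integral_model pmodel tT h1).
  by have := ge_mean0 h_ge tT; rewrite unlock => ->.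
have mk : measurable_fun [set: Y] k.
  have -> : k = (fun y => 'D_1 (fun t => h t y * p t y) theta * (p theta y)^-1).
    by apply/funext => y; rewrite Dhp mulfK// gt_eqF.
  apply: measurable_funM; first by have /integrableP[/measurable_EFinP] := iD.
  apply: measurable_funV_ge0; first exact: (density_measurable pmodel).
  by move=> y; rewrite ltW.
have ik : (P theta).-integrable [set: Y] (EFin \o k).
  apply/(integrable_model pmodel thT mk).
  by under [EFin \o _]eq_fun do rewrite -Dhp.
have ihs : (P theta).-integrable [set: Y]
    (EFin \o (fun y => h theta y * score p theta y)).
  apply: Lfun2_integrableM; first exact: (ge_sqr_integrable h_ge).
  exact: (ge_sqr_integrable p_ge).
rewrite unlock -[LHS]/(\int[P theta]_y (derive1 (h^~ y) theta)).
have -> : \int[P theta]_y (derive1 (h^~ y) theta) =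
    \int[P theta]_y (k y - h theta y * score p theta y).
  by apply: eq_Rintegral => y _; rewrite /k addrK.
rewrite RintegralB//.
suff -> : \int[P theta]_y k y = 0 by rewrite sub0r.
rewrite -Z0 /Rintegral (integral_model pmodel thT ik).
by under [in RHS]eq_integral do rewrite Dhp.
Unshelve. all: by end_near. Qed.

Hypotheses (ST : forall y, S (T y)) (cTheta : connected Theta).
Hypothesis g_dui :
  diff_under_integral nu setT Theta (fun theta y => g theta y * p theta y).
Hypothesis I_gt0 : forall theta, Theta theta -> 0 < fisher P p theta.

Let gE theta : g theta = dirscore q 1 theta \o T.
Proof. exact: score_dirscore. Qed.

Let s2 theta : Theta theta -> dirscore p 1 theta \in Lfun (P theta) 2%:E.
Proof. by rewrite -score_dirscore; exact: (ge_sqr_integrable p_ge). Qed.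

Let g2 theta : Theta theta -> dirscore q 1 theta \o T \in Lfun (P theta) 2%:E.
Proof. by rewrite -gE; exact: (ge_sqr_integrable g_ge). Qed.

Let s0 theta : Theta theta -> ('E_(P theta)[dirscore p 1%R theta] = 0)%E.
Proof. by rewrite -score_dirscore; exact: (ge_mean0 p_ge). Qed.

Let g0 theta : Theta theta -> ('E_(P theta)[dirscore q 1%R theta \o T] = 0)%E.
Proof. by rewrite -gE; exact: (ge_mean0 g_ge). Qed.

Lemma fisherE theta : Theta theta -> fisher P p theta =
  \int[P theta]_y (dirscore p 1 theta y * dirscore p 1 theta y).
Proof.
by move=> thT; rewrite /fisher /variance score_dirscore covariance_centered ?s2 ?s0.
Qed.

Lemma fisher_marginalE theta : Theta theta -> fisher (marginal P T) q theta =
  \int[P theta]_y (g theta y * g theta y).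
Proof.
move=> thT; rewrite /fisher /variance score_dirscore gE.
exact: (marginal_covariance oTheta qmodel thT (g2 thT) (g2 thT) (g0 thT)).
Qed.

Lemma fisher_gap theta : Theta theta ->
  fisher P p theta - fisher (marginal P T) q theta =
  \int[P theta]_y (gap p T q 1 theta y * gap p T q 1 theta y).
Proof.
move=> thT; rewrite fisherE// fisher_marginalE// (gE theta).
by rewrite (integral_gap_gap oTheta pmodel qmodel thT (s2 thT) (s2 thT)
  (g2 thT) (g2 thT)).
Qed.

Lemma Lambda_marginal_score theta : Theta theta ->
  Lambda P g theta = fisher (marginal P T) q theta.
Proof.
move=> thT; rewrite /Lambda (expectation_derive1 g_ge thT g_dui) sqrrN.
have -> : fine ('V_(P theta)[g theta])%E = fisher (marginal P T) q theta.
  rewrite fisher_marginalE// /variance (gE theta).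
  exact: (covariance_centered (g2 thT) (g2 thT) (g0 thT)).
have -> : \int[P theta]_y (g theta y * score p theta y) =
    fisher (marginal P T) q theta.
  rewrite (fisher_marginalE thT).
  rewrite (score_dirscore p theta).
  rewrite (gE theta).
  exact: (score_marginal_score oTheta pmodel qmodel thT (s2 thT) (g2 thT) (g2 thT)).
(* if the marginal score is degenerate, both sides are 0 since 0 / 0 = 0 *)
rewrite expr2; have [->|I0] := eqVneq (fisher (marginal P T) q theta) 0.
  by rewrite mul0r mul0r.
by rewrite mulfK.
Qed.

Lemma scalar_efficiency :
  (forall theta, Theta theta ->
     [/\ Lambda P g theta = fisher (marginal P T) q theta,
         Eff P p g theta = fisher (marginal P T) q theta / fisher P p theta &
         fisher (marginal P T) q theta / fisher P p theta <= 1]) /\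
  ((forall theta, Theta theta -> Eff P p g theta = 1) <-> sufficient Theta P T).
Proof.
have EffE theta : Theta theta ->
    Eff P p g theta = fisher (marginal P T) q theta / fisher P p theta.
  by move=> thT; rewrite /Eff Lambda_marginal_score.
split=> [theta thT|].
  split; [exact: Lambda_marginal_score|exact: EffE|].
  rewrite ler_pdivrMr ?I_gt0// mul1r -subr_ge0 fisher_gap//.
  exact: gap_sqr_ge0.
have locconst (F : R -> R) :
    (forall x (j : unit), Theta x -> is_derive x ((fun=> 1) j : R) F 0) ->
    forall x, Theta x -> \forall y \near x, F y = F x.
  by move=> dF; exact: (locally_constant_line oTheta (fun x => dF x tt)).
apply: iff_trans
  (gap0_sufficient oTheta pmodel qmodel ST (@dense_rat R) locconst cTheta).
have I_neq0 theta thT := lt0r_neq0 (I_gt0 (theta := theta) thT).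
have D2 theta thT := gap_Lfun2 (s2 (theta := theta) thT) (g2 thT).
split=> [eff1 theta _ thT|gap0 theta thT].
  apply: (gap_sqr_eq0 pmodel thT (D2 _ thT)).
  rewrite -fisher_gap//; have := eff1 theta thT; rewrite EffE//.
  by move=> /divr1_eq ->; rewrite subrr.
rewrite EffE//; apply/eqP; rewrite -subr_eq0 -(divff (I_neq0 _ thT)) -mulrBl.
rewrite -opprB fisher_gap// (integral_gap_eq0 pmodel thT (D2 _ thT) (D2 _ thT)).
  by rewrite oppr0 mul0r.
exact: (gap0 theta tt thT).
Qed.

End ScalarParameter.

(** * Multivariate parameter *)

Section GramMatrix.
Context {R : realType} d {Y : measurableType d} (P : probability Y R).

Lemma Rintegral_sum (I : Type) (r : seq I) (F : I -> Y -> R) :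
  (forall i, P.-integrable [set: Y] (EFin \o F i)) ->
  \int[P]_y (\sum_(i <- r) F i y) = \sum_(i <- r) \int[P]_y F i y.
Proof.
move=> iF; rewrite /Rintegral.
under eq_integral do rewrite -sumEFin.
rewrite integral_sum//.
rewrite (eq_bigr (fun i => (fine (\int[P]_y (F i y)%:E))%:E)) => [|i _].
  by rewrite sumEFin.
by rewrite fineK//; apply: integrable_fin_num => //; exact: iF.
Qed.

Lemma gram_matrix_psd k (X : 'I_k -> Y -> R) :
  (forall i, X i \in Lfun P 2%:E) ->
  psdmx (\matrix_(i, j) \int[P]_y (X i y * X j y)).
Proof.
move=> X2; split=> [|u].
  by apply/matrixP => i j; rewrite !mxE; apply: eq_Rintegral => y _; rewrite mulrC.
have iXX i j : P.-integrable [set: Y] (EFin \o (fun y => X i y * X j y)).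
  exact: Lfun2_integrableM.
have iuXX i j : P.-integrable [set: Y]
    (EFin \o (fun y => u 0 i * u 0 j * (X i y * X j y))).
  under [EFin \o _]eq_fun do rewrite EFinM.
  exact: (integrableZl measurableT (u 0 i * u 0 j) (iXX i j)).
suff -> : (u *m \matrix_(i, j) \int[P]_y (X i y * X j y) *m u^T) 0 0 =
    \int[P]_y ((\sum_i u 0 i * X i y) ^+ 2).
  by apply: Rintegral_ge0 => y _; exact: sqr_ge0.
transitivity (\int[P]_y (\sum_j \sum_i u 0 i * u 0 j * (X i y * X j y))).
  rewrite mxE Rintegral_sum.
    apply: eq_bigr => j _; rewrite !mxE mulr_suml.
    rewrite Rintegral_sum => [|i]; last exact: iuXX.
    apply: eq_bigr => i _; rewrite mxE RintegralZl//.
    by rewrite mulrAC.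
  move=> j; under [EFin \o _]eq_fun do rewrite -sumEFin.
  by apply: integrable_sum => // i _; exact: iuXX.
apply: eq_Rintegral => y _; rewrite expr2 mulr_sumr; apply: eq_bigr => j _.
by rewrite mulr_suml; apply: eq_bigr => i _; rewrite mulrACA.
Qed.

End GramMatrix.

Section LoewnerBound.
Context {R : realType} {k : nat}.
Implicit Types A K : 'M[R]_k.

Lemma invsqrtmx_sandwich A : pdmx A -> invsqrtmx A *m A *m invsqrtmx A = 1%:M.
Proof.
move=> Apd; have [_ SS] := invsqrtmxP Apd.
have Au := pdmx_unit Apd.
have /mulmx1C : invsqrtmx A *m (invsqrtmx A *m A) = 1%:M.
  by rewrite mulmxA SS mulVmx.
exact.
Qed.

Lemma invsqrtmx_sandwich_inj A K : pdmx A ->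
  invsqrtmx A *m K *m invsqrtmx A = 1%:M -> K = A.
Proof.
move=> Apd; rewrite -(invsqrtmx_sandwich Apd) => E.
have /mulmx1_unit[] := invsqrtmx_sandwich Apd; rewrite unitmx_mul => /andP[Su _] _.
by move: E => /(can_inj (mulmxK Su)) /(can_inj (mulKmx Su)).
Qed.

Lemma lemx_invsqrtmx_sandwich A K : pdmx A -> lemx K A ->
  lemx (invsqrtmx A *m K *m invsqrtmx A) 1%:M.
Proof.
move=> Apd [AKT AK0]; have [[ST _] _] := invsqrtmxP Apd.
rewrite /lemx -(invsqrtmx_sandwich Apd) -mulmxBl -mulmxBr.
split=> [|u]; first by rewrite !trmx_mul AKT ST mulmxA.
have := AK0 (u *m invsqrtmx A).
by rewrite trmx_mul ST !mulmxA.
Qed.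

End LoewnerBound.

Section MultivariateParameter.
Context {R : realType} {k : nat} d {Y : measurableType d}
  (nu : {measure set Y -> \bar R})
  (Theta : set 'rV[R]_k) (P : 'rV[R]_k -> probability Y R)
  (p : 'rV[R]_k -> Y -> R) dZ {Z : measurableType dZ} (T : {mfun Y >-> Z})
  (la : {measure set Z -> \bar R}) (q : 'rV[R]_k -> Z -> R) (S : set Z).
Hypotheses (oTheta : open Theta) (cTheta : connected Theta)
  (pmodel : regular_model nu Theta P p [set: Y])
  (qmodel : regular_model la Theta (marginal P T) q S)
  (ST : forall y, S (T y)).
Let g : 'rV[R]_k -> Y -> 'rV[R]_k := mscore (fun mu y => q mu (T y)).
Let I := mfisher P p.
Let I_T := mfisher (marginal P T) q.
Hypotheses
  (p_ge : forall j, generalized_estimator Theta P (fun mu y => mscore p mu y 0 j))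
  (g_ge : forall j, generalized_estimator Theta P (fun mu y => g mu y 0 j))
  (I_pd : forall mu, Theta mu -> pdmx (I mu)).
Local Notation e j := (delta_mx 0 j : 'rV[R]_k).
Local Notation s j mu := (dirscore p (e j) mu).
Local Notation h j mu := (dirscore q (e j) mu \o T).

Lemma mscore_dirscore (U : Type) (f : 'rV[R]_k -> U -> R) mu j :
  (fun y => mscore f mu y 0 j) = dirscore f (e j) mu.
Proof. by apply/funext => y; rewrite mxE. Qed.

Let gE mu j : (fun y => g mu y 0 j) = h j mu.
Proof. exact: mscore_dirscore. Qed.

Let s2 mu j : Theta mu -> s j mu \in Lfun (P mu) 2%:E.
Proof. by rewrite -mscore_dirscore; exact: (ge_sqr_integrable (p_ge j)). Qed.

Let h2 mu j : Theta mu -> h j mu \in Lfun (P mu) 2%:E.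
Proof. by rewrite -gE; exact: (ge_sqr_integrable (g_ge j)). Qed.

Let s0 mu j : Theta mu -> ('E_(P mu)[s j mu] = 0)%E.
Proof. by rewrite -mscore_dirscore; exact: (ge_mean0 (p_ge j)). Qed.

Let h0 mu j : Theta mu -> ('E_(P mu)[h j mu] = 0)%E.
Proof. by rewrite -gE; exact: (ge_mean0 (g_ge j)). Qed.

Lemma mfisherE mu i j : Theta mu ->
  I mu i j = \int[P mu]_y (s i mu y * s j mu y).
Proof.
move=> muT; rewrite mxE (mscore_dirscore p mu i) (mscore_dirscore p mu j).
exact: (covariance_centered (s2 i muT) (s2 j muT) (s0 i muT)).
Qed.

Lemma mfisher_marginalE mu i j : Theta mu ->
  I_T mu i j = \int[P mu]_y (h i mu y * h j mu y).
Proof.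
move=> muT; rewrite mxE (mscore_dirscore q mu i) (mscore_dirscore q mu j).
exact: (marginal_covariance oTheta qmodel muT (h2 i muT) (h2 j muT) (h0 i muT)).
Qed.

Lemma mfisher_gap mu i j : Theta mu ->
  (I mu - I_T mu) i j =
  \int[P mu]_y (gap p T q (e i) mu y * gap p T q (e j) mu y).
Proof.
move=> muT; rewrite mxE mfisherE// [X in _ + X]mxE mfisher_marginalE//.
by rewrite (integral_gap_gap oTheta pmodel qmodel muT (s2 i muT) (s2 j muT)
  (h2 i muT) (h2 j muT)).
Qed.

Lemma covmx_marginal_score mu : Theta mu -> covmx P g g mu = I_T mu.
Proof.
move=> muT; apply/matrixP => i j.
rewrite mfisher_marginalE// mxE (gE mu i) (gE mu j).
exact: (covariance_centered (h2 i muT) (h2 j muT) (h0 i muT)).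
Qed.

Lemma covmx_marginal_score_score mu : Theta mu ->
  covmx P g (mscore p) mu = I_T mu.
Proof.
move=> muT; apply/matrixP => i j.
rewrite mfisher_marginalE// mxE (gE mu i) (mscore_dirscore p mu j).
rewrite (covariance_centered (h2 i muT) (s2 j muT) (h0 i muT)).
exact: (score_marginal_score oTheta pmodel qmodel muT (s2 j muT) (h2 j muT)
  (h2 i muT)).
Qed.

Lemma mfisher_marginal_sym mu : Theta mu -> (I_T mu)^T = I_T mu.
Proof.
move=> muT; apply/matrixP => i j.
rewrite mxE (mfisher_marginalE j i muT) (mfisher_marginalE i j muT).
by apply: eq_Rintegral => y _; exact: mulrC.
Qed.

Lemma mLambda_marginal_score mu : Theta mu ->
  mLambda P p g mu = I_T mu *m invmx (I_T mu) *m I_T mu.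
Proof.
move=> muT; rewrite /mLambda covmx_marginal_score// covmx_marginal_score_score//.
by rewrite mfisher_marginal_sym.
Qed.

Lemma mfisher_marginal_le mu : Theta mu -> lemx (I_T mu) (I mu).
Proof.
move=> muT; rewrite /lemx.
have -> : I mu - I_T mu = \matrix_(i, j)
    \int[P mu]_y (gap p T q (e i) mu y * gap p T q (e j) mu y).
  by apply/matrixP => i j; rewrite mfisher_gap// mxE.
apply: gram_matrix_psd => i.
exact: gap_Lfun2 (s2 i muT) (h2 i muT).
Qed.

Lemma mfisher_marginal_eq_gap0 : (forall mu, Theta mu -> I_T mu = I mu) <->
  (forall mu j, Theta mu -> {ae nu, forall y, gap p T q (e j) mu y = 0}).
Proof.
have D2 mu j (muT : Theta mu) := gap_Lfun2 (s2 j muT) (h2 j muT).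
split=> [IE mu j muT|gap0 mu muT].
  apply: (gap_sqr_eq0 pmodel muT (D2 _ j muT)).
  by rewrite -mfisher_gap// IE// subrr mxE.
apply/esym/eqP; rewrite -subr_eq0; apply/eqP/matrixP => i j.
rewrite mfisher_gap// mxE.
exact: (integral_gap_eq0 pmodel muT (D2 _ i muT) (D2 _ j muT) (gap0 mu i muT)).
Qed.

(** If the efficiency is the identity then I_T is invertible, being a factor of
    an invertible product; this excludes the singular case, in which
    [invmx (I_T mu)] is not an inverse. *)
Lemma mEff_eq1 mu : Theta mu -> mEff P p g mu = 1%:M <-> I_T mu = I mu.
Proof.
move=> muT; rewrite /mEff mLambda_marginal_score//; split=> [E|IE].
  have /mulmx1_unit[+ _] := E.
  rewrite !unitmx_mul => /andP[_ /andP[/andP[Ku _] _]].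
  by apply: (invsqrtmx_sandwich_inj (I_pd muT)); rewrite -E mulmxKV.
have Iu := pdmx_unit (I_pd muT).
rewrite IE mulmxV// mul1mx.
exact: (invsqrtmx_sandwich (I_pd muT)).
Qed.

Lemma multivariate_efficiency :
  (forall mu, Theta mu ->
     (covmx P g g mu \in unitmx ->
        mLambda P p g mu = I_T mu /\
        mEff P p g mu = invsqrtmx (I mu) *m I_T mu *m invsqrtmx (I mu)) /\
     lemx (invsqrtmx (I mu) *m I_T mu *m invsqrtmx (I mu)) 1%:M) /\
  ((forall mu, Theta mu -> mEff P p g mu = 1%:M) <-> sufficient Theta P T).
Proof.
split=> [mu muT|].
  split; last first.
    exact: lemx_invsqrtmx_sandwich (I_pd muT) (mfisher_marginal_le muT).
  rewrite covmx_marginal_score// => Ku.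
  have LE : mLambda P p g mu = I_T mu.
    by rewrite mLambda_marginal_score// mulmxV// mul1mx.
  by rewrite /mEff LE.
have locconst (F : 'rV[R]_k -> R) :
    (forall x j, Theta x -> is_derive x (e j) F 0) ->
    forall x, Theta x -> \forall y \near x, F y = F x.
  exact: locally_constant_rV.
apply: iff_trans (gap0_sufficient oTheta pmodel qmodel ST
  (@dense_rat_rV R k) locconst cTheta).
apply: iff_trans mfisher_marginal_eq_gap0.
by split=> eq1 mu muT; apply/mEff_eq1 => //; exact: eq1.
Qed.

End MultivariateParameter.

Theorem mainTheorem3 (R : realType) (d : measure_display)
    (Y : measurableType d) (nu : {sigma_finite_measure set Y -> \bar R}) :
  (forall (Theta : set R) (P : R -> probability Y R) (p : R -> Y -> R)
      (T : {mfun Y >-> R}) (la : {sigma_finite_measure set R -> \bar R})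
      (q : R -> R -> R) (S : set R),
    let g := score (fun theta y => q theta (T y)) in
    let I := fisher P p in
    let I_T := fisher (marginal P T) q in
    open Theta -> connected Theta -> identifiable Theta P ->
    regular_model nu Theta P p setT ->
    generalized_estimator Theta P (score p) ->
    (forall theta, Theta theta -> 0 < I theta) ->
    regular_model la Theta (marginal P T) q S -> (forall y, S (T y)) ->
    generalized_estimator Theta P g ->
    diff_under_integral nu setT Theta (fun theta y => g theta y * p theta y) ->
    (forall theta, Theta theta ->
       [/\ Lambda P g theta = I_T theta,
           Eff P p g theta = I_T theta / I theta &
           I_T theta / I theta <= 1]) /\
    ((forall theta, Theta theta -> Eff P p g theta = 1) <->
     sufficient Theta P T)) /\
  (forall (k : nat) (Theta : set 'rV[R]_k) (P : 'rV[R]_k -> probability Y R)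
      (p : 'rV[R]_k -> Y -> R) (T : {mfun Y >-> borel_rV R k})
      (la : {sigma_finite_measure set (borel_rV R k) -> \bar R})
      (q : 'rV[R]_k -> borel_rV R k -> R) (S : set (borel_rV R k)),
    let g := mscore (fun mu y => q mu (T y)) in
    let I := mfisher P p in
    let I_T := mfisher (marginal P T) q in
    open Theta -> connected Theta -> identifiable Theta P ->
    regular_model nu Theta P p setT ->
    (forall j, generalized_estimator Theta P (fun mu y => mscore p mu y 0 j)) ->
    (forall mu, Theta mu -> pdmx (I mu)) ->
    regular_model la Theta (marginal P T) q S -> (forall y, S (T y)) ->
    (forall i, generalized_estimator Theta P (fun mu y => g mu y 0 i)) ->
    (forall mu, Theta mu ->
       (covmx P g g mu \in unitmx ->
          mLambda P p g mu = I_T mu /\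
          mEff P p g mu =
            invsqrtmx (I mu) *m I_T mu *m invsqrtmx (I mu)) /\
       lemx (invsqrtmx (I mu) *m I_T mu *m invsqrtmx (I mu)) 1%:M) /\
    ((forall mu, Theta mu -> mEff P p g mu = 1%:M) <->
     sufficient Theta P T)).
Proof.
split.
- move=> Theta P p T la q S g I I_T oTheta cTheta _ pmodel p_ge I_gt0.
  move=> qmodel ST g_ge g_dui.
  exact: (scalar_efficiency oTheta pmodel qmodel p_ge g_ge ST cTheta g_dui I_gt0).
- move=> k Theta P p T la q S g I I_T oTheta cTheta _ pmodel p_ge I_pd.
  move=> qmodel ST g_ge.
  exact: (multivariate_efficiency oTheta cTheta pmodel qmodel ST p_ge g_ge I_pd).
Qed.
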